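(* Let $d\ge2$, $q\in[1,\infty)$, and let $\mathcal X$ and $\mathcal Y$ be compact convex subsets of $\mathbb R^d$. Let $M>0$, $\theta\in(0,1]$, and let $\rho_0$ be a probability measure on $\mathcal X$ satisfying $\rho_0(B_\eta(x))\le M\eta^{d-1+\theta}$ for every $x\in\mathbb R^d$ and $\eta>0$. Let $\mu_0\in\mathcal P(\mathcal Y)$, and let $\gamma_{\rho_0\to\mu_0}\in\Gamma(\rho_0,\mu_0)$ be the unique optimal plan between them. Then for all $\rho_1\in\mathcal P(\mathcal X)$, all $\mu_1\in\mathcal P(\mathcal Y)$ and any optimal plan $\gamma_{\rho_1\to\mu_1}\in\Gamma(\rho_1,\mu_1)$, $$W_q(\gamma_{\rho_0\to\mu_0},\gamma_{\rho_1\to\mu_1})\le C\Big(W_1(\rho_0,\rho_1)+W_1(\mu_0,\mu_1)\Big)^{\frac{\theta}{q(1+\theta)}},$$ where $C=2\max(D_{\mathcal X},D_{\mathcal Y})^{\frac{\theta}{q(1+\theta)}}\,C'$ and $$(C')^q=D_{\mathcal X}^{\,q-1+\frac1{1+\theta}}D_{\mathcal Y}^{-\frac{\theta}{1+\theta}}+D_{\mathcal Y}^{\,q}\left(1+c_dMD_{\mathcal X}^{d-1+\theta}\right)(D_{\mathcal Y}D_{\mathcal X})^{-\frac{\theta}{1+\theta}}.$$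
   Context: $\mathcal P(E)$ is the set of Borel probability measures on $E$, and $B_\eta(x)$ is the open Euclidean ball. $D_{\mathcal X}=\operatorname{diam}(\mathcal X)$, $D_{\mathcal Y}=\operatorname{diam}(\mathcal Y)$. $\beta_k$ is the volume of the unit ball of $\mathbb R^k$ and $c_d=\frac43\,\frac{6^d d^2(d+1)\beta_d}{\beta_{d-1}}$. The constant $C'$ is read as $+\infty$ (nothing is asserted) if $D_{\mathcal Y}=0$. $\Pi(\rho,\mu)$ is the set of couplings (transport plans) of $\rho$ and $\mu$, and $\Gamma(\rho,\mu)$ is the set of minimisers of $\int\|x-y\|^2\,d\gamma(x,y)$ over $\gamma\in\Pi(\rho,\mu)$ (optimal plans); under the stated condition on $\rho_0$ the optimal plan from $\rho_0$ is unique (Brenier-McCann). $W_1(\rho,\mu)=\min_{\gamma\in\Pi(\rho,\mu)}\int\|x-y\|\,d\gamma$ on $\mathbb R^d$. For probability measures $\gamma_0,\gamma_1$ on $\mathbb R^d\times\mathbb R^d$, $W_q^q(\gamma_0,\gamma_1)=\inf_{\pi\in\Pi(\gamma_0,\gamma_1)}\int\|x_0-x_1\|^q+\|y_0-y_1\|^q\,d\pi(x_0,y_0,x_1,y_1)$. *)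

(* Defs.v *)
From HB Require Import structures.
From mathcomp Require Import all_boot all_order all_algebra.
From mathcomp Require Import all_classical all_reals all_analysis.

Set Implicit Arguments.
Unset Strict Implicit.
Unset Printing Implicit Defensive.

Import Order.TTheory GRing.Theory Num.Theory.
Import numFieldNormedType.Exports.

Local Open Scope classical_set_scope.
Local Open Scope ring_scope.

Section euclidean.
Variable R : realType.

(* The library's norm on ['rV[R]_d] is the sup norm, so the Euclidean norm is
   defined here; the two norms induce the same topology, hence the same
   compact, open and Borel sets. *)
Definition enorm (d : nat) (x : 'rV[R]_d) : R :=
  Num.sqrt (\sum_(i < d) x 0 i ^+ 2).

Definition eball (d : nat) (x : 'rV[R]_d) (eta : R) : set 'rV[R]_d :=
  [set y | enorm (y - x) < eta].

Definition diam (d : nat) (A : set 'rV[R]_d) : R :=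
  sup [set enorm (x - y) | x in A & y in A].

(* Lebesgue measure of a Borel subset of R^k. Only the one-dimensional Lebesgue
   measure is in the library; this is the k-fold product measure, obtained by
   integrating the measure of the sections along the first coordinate, exactly
   as in [product_measure1]. R^0 is a point of mass 1. *)
Fixpoint volume (k : nat) : set 'rV[R]_k -> \bar R :=
  match k return set 'rV[R]_k -> \bar R with
  | 0%N => fun A => (\1_A 0)%:E
  | k'.+1 => fun A =>
      (\int[@lebesgue_measure R]_t
         volume [set v : 'rV[R]_k' | A (row_mx (const_mx t : 'rV[R]_1) v)])%E
  end.

Definition beta (k : nat) : R := fine (volume (eball (0 : 'rV[R]_k) 1)).

Definition c_ (d : nat) : R :=
  4 / 3 * (6 ^+ d * d%:R ^+ 2 * d.+1%:R * beta d / beta d.-1).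

Definition borel_rV (d : nat) := g_sigma_algebraType (@open 'rV[R]_d).

End euclidean.

Section transport.
Context {R : realType} {d1 d2 : measure_display}
  {T1 : measurableType d1} {T2 : measurableType d2}.

(* Marginals are compared on measurable sets only: the values of a library
   measure outside the sigma-algebra are meaningless. *)
Definition coupling (P1 : probability T1 R) (P2 : probability T2 R)
    : set (probability (T1 * T2)%type R) :=
  [set pi | (forall A, measurable A -> pi (fst @^-1` A) = P1 A) /\
            (forall B, measurable B -> pi (snd @^-1` B) = P2 B)].

Definition transport_cost (c : T1 * T2 -> R)
    (P1 : probability T1 R) (P2 : probability T2 R) : \bar R :=
  ereal_inf [set (\int[pi]_z (c z)%:E)%E | pi in coupling P1 P2].

Definition optimal_plan (c : T1 * T2 -> R)
    (P1 : probability T1 R) (P2 : probability T2 R)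
    : set (probability (T1 * T2)%type R) :=
  [set pi | coupling P1 P2 pi /\
     forall pi', coupling P1 P2 pi' ->
       (\int[pi]_z (c z)%:E <= \int[pi']_z (c z)%:E)%E].

End transport.

Section wasserstein.
Context {R : realType} {d : nat}.
Local Notation E := (borel_rV R d).

Definition Gamma (rho mu : probability E R)
    : set (probability (E * E)%type R) :=
  optimal_plan (fun z : E * E => enorm (z.1 - z.2 : 'rV[R]_d) ^+ 2) rho mu.

Definition W1 (rho mu : probability E R) : \bar R :=
  transport_cost (fun z : E * E => enorm (z.1 - z.2 : 'rV[R]_d)) rho mu.

Definition Wplan (q : R) (gamma0 gamma1 : probability (E * E)%type R) : \bar R :=
  (transport_cost
    (fun z : (E * E) * (E * E) =>
       enorm (z.1.1 - z.2.1 : 'rV[R]_d) `^ q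
       + enorm (z.1.2 - z.2.2 : 'rV[R]_d) `^ q)%R
    gamma0 gamma1 `^ q^-1)%E.

End wasserstein.

Section constants.
Variable R : realType.

Definition C'_ (d : nat) (q M theta DX DY : R) : R :=
  (DX `^ (q - 1 + (1 + theta)^-1) * DY `^ (- (theta / (1 + theta)))
   + DY `^ q * (1 + c_ R d * M * DX `^ (d%:R - 1 + theta))
     * (DY * DX) `^ (- (theta / (1 + theta)))) `^ q^-1.

Definition C_ (d : nat) (q M theta DX DY : R) : R :=
  2 * Num.max DX DY `^ (theta / (q * (1 + theta))) * C'_ d q M theta DX DY.

End constants.

(* Main.v *)
Require Import Defs.
From HB Require Import structures.
From mathcomp Require Import all_boot all_order all_algebra.
From mathcomp Require Import all_classical all_reals all_analysis.
From mathcomp Require Import measurable_realfun.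
From mathcomp Require Import ring lra zify.

Set Implicit Arguments.
Unset Strict Implicit.
Unset Printing Implicit Defensive.

Import Order.TTheory GRing.Theory Num.Theory.
Import numFieldNormedType.Exports.

Local Open Scope classical_set_scope.
Local Open Scope ring_scope.

(** An optimal plan for the quadratic cost sits on the graph of the
    subdifferential of a convex function: there are conjugate potentials
    [(phi_i, psi_i)] on which [gamma_i] is concentrated
    ([optimal_potentials]). The theorem compares the two plans through the
    nonnegative duality gap
    [phi1 x + psi1 y - dot x y], which vanishes on the second plan.

    The gap is small in the mean on the first plan. Since [phi1 - phi0] and
    [psi1 - psi0] are Lipschitz with constants [diam Y] and [diam X], its
    integral against [gamma0] is at most
    [diam Y * W1 rho0 rho1 + diam X * W1 mu0 mu1] ([potential_gap_le]).

    A small gap at [(x0, y0)] makes [y0] close to every [y1] in the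
    subdifferential of [phi1] at a point [x1] near [x0]. Moving from [x0] by
    [eta] in the direction of [y0 - y1] shows that [enorm (y0 - y1)] is at most
    the oscillation of this subdifferential in a ball of radius of order [eta],
    plus the gap divided by [eta] ([subgrad_dist_le]). When [x0] and [x1] are
    further apart than [eta], the bound
    [diam Y * enorm (x0 - x1) / eta] takes over. The two plans are coupled by
    imposing a nearly optimal coupling of [rho0] and [rho1] on the first
    coordinates ([coupling_of_plans]), so that [enorm (x0 - x1)] integrates to
    about [W1 rho0 rho1].

    What remains is the integral against [rho0] of the oscillation at scale
    [eta], and this is where the growth of [rho0] enters. On a grid of cells of
    size [eta], each cell has mass at most [M * eta `^ (d - 1 + theta)], so that
    it suffices to bound the sum of the oscillations over the cells by a
    multiple of [eta `^ (1 - d)] ([grid_osc_le]). By convexity the oscillation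
    in a ball is controlled by the increments of a selection of the
    subdifferential along the coordinate axes ([osc_le_slope_gap]); along each
    column of cells these increments telescope and sum to a multiple of
    [diam Y] ([window_sum_le]), and the number of columns that meet the domain
    is of order [eta `^ (1 - d)] ([card_columns_le]). Hence the integral is at
    most a constant times [eta `^ theta] ([integral_osc_le]); that [c_ R d] is
    large enough as a constant follows from a lower bound on the ratio of the
    volumes of the unit balls ([beta_ratio_ge]).

    All three contributions balance for [eta = s * diam X], where
    [s = t `^ (1 + theta)^-1] and [t] is
    [max (diam X) (diam Y) * w / (diam X * diam Y)], for any [w] above the sum of
    the two Wasserstein distances ([transport_cost_le]); then [w] decreases to
    that sum. The grid estimate requires [s] to be small. Otherwise the bound
    exceeds the diameters, because the growth condition, applied to a ball that
    contains [X], forces [M] to be large ([constant_ge108]). *)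

(** * The Euclidean inner product *)

Section inner_product.
Context {R : realType} {d : nat}.
Implicit Types x y z : 'rV[R]_d.

Definition dot x y : R := \sum_(i < d) x 0 i * y 0 i.

Lemma dotC x y : dot x y = dot y x.
Proof. by apply: eq_bigr => i _; rewrite mulrC. Qed.

Lemma dotDl x y z : dot (x + y) z = dot x z + dot y z.
Proof. by rewrite -big_split; apply: eq_bigr => i _; rewrite mxE mulrDl. Qed.

Lemma dotNl x z : dot (- x) z = - dot x z.
Proof. by rewrite -sumrN; apply: eq_bigr => i _; rewrite mxE mulNr. Qed.

Lemma dotZl a x z : dot (a *: x) z = a * dot x z.
Proof. by rewrite mulr_sumr; apply: eq_bigr => i _; rewrite mxE mulrA. Qed.

Lemma dotBl x y z : dot (x - y) z = dot x z - dot y z.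
Proof. by rewrite dotDl dotNl. Qed.

Lemma dotDr x y z : dot z (x + y) = dot z x + dot z y.
Proof. by rewrite dotC dotDl !(dotC z). Qed.

Lemma dotBr x y z : dot z (x - y) = dot z x - dot z y.
Proof. by rewrite dotC dotBl !(dotC z). Qed.

Lemma dotZr a x z : dot z (a *: x) = a * dot z x.
Proof. by rewrite dotC dotZl (dotC z). Qed.

Lemma dot0l z : dot 0 z = 0.
Proof. by rewrite -(scale0r z) dotZl mul0r. Qed.

Lemma dot_delta x k : dot x (delta_mx 0 k) = x 0 k.
Proof.
rewrite /dot (bigD1 k)//= big1 ?addr0 ?mxE ?eqxx ?mulr1// => i ik.
by rewrite mxE eqxx (negbTE ik) mulr0.
Qed.

Lemma dot_ge0 x : 0 <= dot x x.
Proof. by apply: sumr_ge0 => i _; rewrite -expr2 sqr_ge0. Qed.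

Lemma enorm_ge0 x : 0 <= enorm x.
Proof. exact: sqrtr_ge0. Qed.

Lemma enorm_sqr x : enorm x ^+ 2 = dot x x.
Proof.
have -> : dot x x = \sum_(i < d) x 0 i ^+ 2.
  by apply: eq_bigr => i _; rewrite expr2.
by rewrite sqr_sqrtr//; apply: sumr_ge0 => i _; rewrite sqr_ge0.
Qed.

Lemma enorm0 : enorm (0 : 'rV[R]_d) = 0.
Proof.
by apply/eqP; rewrite -sqrf_eq0 enorm_sqr dot0l.
Qed.

Lemma enormN x : enorm (- x) = enorm x.
Proof. by rewrite /enorm; under eq_bigr do rewrite mxE sqrrN. Qed.

Lemma enormB x y : enorm (x - y) = enorm (y - x).
Proof. by rewrite -opprB enormN. Qed.

Lemma enormZ a x : enorm (a *: x) = `|a| * enorm x.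
Proof.
rewrite /enorm; under eq_bigr do rewrite mxE exprMn.
by rewrite -mulr_sumr sqrtrM ?sqr_ge0// sqrtr_sqr.
Qed.

Lemma enorm_eq0 x : enorm x = 0 -> x = 0.
Proof.
move=> x0; have := enorm_sqr x; rewrite x0 expr0n/= => /esym /eqP.
rewrite psumr_eq0; last by move=> i _; rewrite -expr2 sqr_ge0.
move=> /allP h; apply/rowP => i; rewrite mxE.
by have := h i (mem_index_enum i) => /=; rewrite -expr2 sqrf_eq0 => /eqP.
Qed.

Lemma dot_le_enorm x y : dot x y <= enorm x * enorm y.
Proof.
have [x0|x0] := eqVneq (enorm x) 0.
  by rewrite (enorm_eq0 x0) dot0l enorm0 mul0r.
have [y0|y0] := eqVneq (enorm y) 0.
  by rewrite (enorm_eq0 y0) dotC dot0l enorm0 mulr0.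
have xp : 0 < enorm x by rewrite lt_def x0 enorm_ge0.
have yp : 0 < enorm y by rewrite lt_def y0 enorm_ge0.
have := dot_ge0 (enorm y *: x - enorm x *: y).
rewrite !dotBl !dotBr !dotZl !dotZr (dotC y x) -!enorm_sqr => h.
have : 0 <= 2 * (enorm x * enorm y) * (enorm x * enorm y - dot x y) by nra.
by rewrite pmulr_rge0 ?subr_ge0// !mulr_gt0.
Qed.

Lemma enormD x y : enorm (x + y) <= enorm x + enorm y.
Proof.
rewrite -(@ler_pXn2r _ 2)// ?nnegrE ?addr_ge0 ?enorm_ge0//.
rewrite enorm_sqr dotDl !dotDr (dotC y x) -!enorm_sqr.
have := dot_le_enorm x y; nra.
Qed.

Lemma enorm_triangle z x y : enorm (x - y) <= enorm (x - z) + enorm (z - y).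
Proof. by rewrite -[x - y](subrKA z) enormD. Qed.

Lemma le_dist_dist x y x' y' :
  enorm (x - y) <= enorm (x' - y') + enorm (x - x') + enorm (y - y').
Proof.
have := enorm_triangle x' x y; have := enorm_triangle y' x' y.
rewrite (enormB y' y); lra.
Qed.

Lemma coord_le_enorm x i : `|x 0 i| <= enorm x.
Proof.
rewrite -(@ler_pXn2r _ 2)// ?nnegrE ?enorm_ge0// enorm_sqr real_normK ?num_real//.
rewrite /dot (bigD1 i)//= -expr2 lerDl.
by apply: sumr_ge0 => j _; rewrite -expr2 sqr_ge0.
Qed.

Lemma enorm_le_coord x c :
  0 <= c -> (forall i, `|x 0 i| <= c) -> enorm x <= Num.sqrt d%:R * c.
Proof.
move=> c0 xc; rewrite -(ger0_norm c0) -sqrtr_sqr -sqrtrM// ler_wsqrtr//.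
rewrite mulr_natl -[d in leRHS]card_ord -sumr_const ler_sum// => i _.
by rewrite -[x 0 i ^+ 2]real_normK ?num_real// lerXn2r ?nnegrE.
Qed.

Lemma enorm_le_norm x : enorm x <= Num.sqrt d%:R * `|x|.
Proof.
apply: enorm_le_coord => // i; rewrite [leRHS]mx_normrE.
exact: (le_bigmax _ (fun ij => `|x ij.1 ij.2|) (0, i)).
Qed.

Lemma exists_coord_ge x : (0 < d)%N ->
  exists k, enorm x <= Num.sqrt d%:R * `|x 0 k|.
Proof.
move=> d0; pose k := [arg max_(i > Ordinal d0) `|x 0 i|]%O.
exists k; apply: enorm_le_coord => // i; rewrite /k.
by case: arg_maxP => //= j _; apply.
Qed.

End inner_product.

(** * Compact sets and measurability for the Euclidean norm *)

Section diameter.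
Context {R : realType} {d : nat}.
Implicit Types A : set 'rV[R]_d.

Lemma compact_enorm_bounded A : compact A ->
  exists2 B, 0 < B & forall x, A x -> enorm x <= B.
Proof.
move=> /compact_bounded [M [_ MA]].
exists (Num.sqrt d%:R * (`|M| + 1) + 1) => [|x Ax].
  by rewrite ltr_wpDl// mulr_ge0// ?sqrtr_ge0 ?addr_ge0.
rewrite (le_trans (enorm_le_norm x))// ler_wpDr// ler_wpM2l ?sqrtr_ge0//.
by apply: (MA (`|M| + 1)) => //; rewrite (le_lt_trans (ler_norm _))// ltrDl.
Qed.

Lemma le_diam A x y : compact A -> A x -> A y -> enorm (x - y) <= diam A.
Proof.
move=> /compact_enorm_bounded [B _ AB] Ax Ay; apply: ub_le_sup; last first.
  by exists x => //; exists y.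
exists (B + B) => _ [u Au [v Av <-]].
by rewrite (le_trans (enormD _ _))// enormN lerD// AB.
Qed.

Lemma diam_ge0 A x : compact A -> A x -> 0 <= diam A.
Proof. by move=> cA Ax; apply: le_trans (le_diam cA Ax Ax); exact: enorm_ge0. Qed.

End diameter.

Section measurability.
Context {R : realType} {d : nat}.
Local Notation E := (borel_rV R d).

Lemma open_measurable_borel (A : set 'rV[R]_d) :
  open A -> measurable (A : set E).
Proof. exact: sub_sigma_algebra. Qed.

Lemma compact_measurable_borel (A : set 'rV[R]_d) :
  compact A -> measurable (A : set E).
Proof.
move=> cA; rewrite -(setCK A); apply: measurableC; apply: open_measurable_borel.
by apply: closed_openC; apply: compact_closed cA; exact: norm_hausdorff.
Qed.

Lemma continuous_measurable_borel (f : 'rV[R]_d -> R) :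
  continuous f -> measurable_fun [set: E] (f : E -> R).
Proof.
move=> /continuousP cf; apply: (measurability _ (RGenOpens.measurableE R)).
move=> _ [_ [a [b ->]] <-]; rewrite setTI; apply: open_measurable_borel.
by apply: cf; exact: interval_open.
Qed.

Lemma measurable_coord i : measurable_fun [set: E] (fun x : E => (x : 'rV[R]_d) 0 i).
Proof. by apply: continuous_measurable_borel; exact: coord_continuous. Qed.

Lemma measurable_enorm_sub d' (T : measurableType d') (f g : T -> E) :
  measurable_fun setT f -> measurable_fun setT g ->
  measurable_fun setT (fun t => enorm ((f t : 'rV[R]_d) - g t)).
Proof.
move=> mf mg; apply: (measurableT_comp (continuous_measurable_fun (@sqrt_continuous R))).
apply: measurable_sum => i; apply: measurable_funX.
rewrite (_ : (fun t => _) = (fun t => (f t : 'rV[R]_d) 0 i - (g t : 'rV[R]_d) 0 i)).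
  by apply: measurable_funB; exact: (measurableT_comp (measurable_coord i)).
by apply/funext => t; rewrite !mxE.
Qed.

Lemma measurable_eball (x : 'rV[R]_d) (eta : R) : measurable (eball x eta : set E).
Proof.
rewrite (_ : eball x eta = (fun y : E => enorm ((y : 'rV[R]_d) - x)) @^-1` `]-oo, eta[%classic).
  rewrite -[X in measurable X]setTI.
  by apply: (@measurable_enorm_sub _ E id (cst x)) => //; exact: measurable_itv.
by apply/seteqP; split=> y; rewrite /eball /= in_itv.
Qed.

Lemma measurable_dot d' (T : measurableType d') (f g : T -> E) :
  measurable_fun setT f -> measurable_fun setT g ->
  measurable_fun setT (fun t => dot (f t : 'rV[R]_d) (g t)).
Proof.
move=> mf mg; apply: measurable_sum => i.
by apply: measurable_funM; exact: (measurableT_comp (measurable_coord i)).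
Qed.

End measurability.

(** * Conjugate potentials *)

Section slopes.
Context {R : realType} {d : nat}.
Implicit Types (K : set 'rV[R]_d) (f g : 'rV[R]_d -> R).

(** The increments of [f] are dominated by the support function of [K]; its
    upper bounds [c] replace it, as a supremum would have to be shown finite.
    Unlike a Lipschitz bound by the size of [K], this is insensitive to the
    position of [K]. *)
Definition slopes_in K f := forall u v c,
  (forall x, K x -> dot x (u - v) <= c) -> f u - f v <= c.

Lemma slopes_in_lipschitz K B f : (forall x, K x -> enorm x <= B) ->
  slopes_in K f -> forall u v, `|f u - f v| <= B * enorm (u - v).
Proof.
move=> KB sf u v.
have le u' v' : f u' - f v' <= B * enorm (u' - v').
  apply: sf => x /KB xB; apply: (le_trans (dot_le_enorm _ _)).
  by apply: ler_wpM2r => //; exact: enorm_ge0.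
rewrite ler_norml le andbT lerNl opprB enormB; exact: le.
Qed.

(** The support functions of [K] in the two opposite directions add up to the
    width of [K], hence the diameter of [K] instead of its distance to the
    origin. *)
Lemma slopes_in_sub_lipschitz K f g : compact K ->
  slopes_in K f -> slopes_in K g ->
  forall u v, (f u - g u) - (f v - g v) <= diam K * enorm (u - v).
Proof.
move=> cK sf sg u v.
suff : f u - f v <= diam K * enorm (u - v) - (g v - g u) by lra.
apply: sf => x Kx.
suff : g v - g u <= diam K * enorm (u - v) - dot x (u - v) by lra.
apply: sg => x' Kx'.
have -> : dot x' (v - u) = - dot x' (u - v) by rewrite !dotBr; lra.
suff : dot (x - x') (u - v) <= diam K * enorm (u - v) by rewrite dotBl; lra.
apply: (le_trans (dot_le_enorm _ _)); apply: ler_wpM2r; first exact: enorm_ge0.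
exact: le_diam.
Qed.

Lemma lipschitz_enorm_continuous B f :
  (forall u v, `|f u - f v| <= B * enorm (u - v)) -> continuous f.
Proof.
move=> lip x; apply/(@cvgrPdist_lt _ _ _ (nbhs x) (nbhs_filter x)) => e e0.
have B0 : 0 < `|B| * Num.sqrt d%:R + 1 by rewrite ltr_wpDl// mulr_ge0// sqrtr_ge0.
near=> t; apply: (le_lt_trans (lip x t)).
apply: (@le_lt_trans _ _ ((`|B| * Num.sqrt d%:R + 1) * `|x - t|)).
  rewrite (@le_trans _ _ (`|B| * (Num.sqrt d%:R * `|x - t|)))//.
    rewrite (le_trans (ler_wpM2r (enorm_ge0 _) (ler_norm B)))//.
    by rewrite ler_wpM2l// enorm_le_norm.
  by rewrite mulrA ler_wpM2r// lerDl.
rewrite mulrC -ltr_pdivlMr//; near: t.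
by have := nbhsx_ballx x _ (divr_gt0 e0 B0); rewrite -ball_normE.
Unshelve. all: by end_near.
Qed.

End slopes.

Section contact.
Context {R : realType} {d : nat}.
Variables (Y : set 'rV[R]_d) (phi psi : 'rV[R]_d -> R).

(** [phi] is the convex conjugate, attained, of [psi] on [Y]. *)
Definition conjugate :=
  (forall z y, Y y -> dot z y <= phi z + psi y) /\
  (forall z, exists2 y, Y y & phi z + psi y = dot z y).

(** The pairs where the Fenchel inequality is tight: the part over [Y] of the
    graph of the subdifferential of [phi]. *)
Definition subgrad z y := Y y /\ phi z + psi y = dot z y.

Hypothesis conj : conjugate.

Lemma subgrad_le z y z' : subgrad z y -> phi z + dot (z' - z) y <= phi z'.
Proof. by move=> [Yy e]; have := conj.1 z' y Yy; rewrite dotBl; lra. Qed.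

Lemma subgrad_monotone x y x' y' :
  subgrad x y -> subgrad x' y' -> 0 <= dot (x - x') (y - y').
Proof.
move=> xy xy'; have := subgrad_le x' xy; have := subgrad_le x xy'.
by rewrite !dotBl !dotBr; lra.
Qed.

Lemma conjugate_slopes_in : slopes_in Y phi.
Proof.
move=> u v c h; have [y Yy e] := conj.2 u.
have := @subgrad_le u y v (Logic.conj Yy e); have := h y Yy.
by rewrite (dotC y) !dotBl; lra.
Qed.

Definition osc (c : 'rV[R]_d) (r : R) : R :=
  sup [set a | exists x y x' y', [/\ subgrad x y, subgrad x' y',
    enorm (x - c) <= r, enorm (x' - c) <= r & a = enorm (y - y')]].

Hypothesis compact_Y : compact Y.

Lemma le_osc c r x y x' y' : subgrad x y -> subgrad x' y' ->
  enorm (x - c) <= r -> enorm (x' - c) <= r -> enorm (y - y') <= osc c r.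
Proof.
move=> xy xy' xr xr'; apply: ub_le_sup; last by exists x, y, x', y'.
exists (diam Y) => _ [u [v [u' [v' [[Yv _] [Yv' _] _ _ ->]]]]].
exact: le_diam.
Qed.

Lemma osc_le c r a : 0 <= r ->
  (forall x y x' y', subgrad x y -> subgrad x' y' ->
    enorm (x - c) <= r -> enorm (x' - c) <= r -> enorm (y - y') <= a) ->
  osc c r <= a.
Proof.
move=> r0 h; apply: ge_sup; last by move=> _ [x [y [x' [y' [? ? ? ? ->]]]]]; exact: (h x y x' y').
have [y Yy e] := conj.2 c; have cy : subgrad c y by split.
by exists (enorm (y - y)), c, y, c, y; split=> //; rewrite subrr enorm0.
Qed.

Lemma osc_ge0 c r : 0 <= r -> 0 <= osc c r.
Proof.
move=> r0; have [y Yy e] := conj.2 c; have cy : subgrad c y by split.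
apply: (@le_trans _ _ (enorm (y - y))); first exact: enorm_ge0.
by apply: (@le_osc c r c y c y) => //; rewrite subrr enorm0.
Qed.

Variable sel : 'rV[R]_d -> 'rV[R]_d.
Hypothesis selP : forall z, subgrad z (sel z).

Definition slope_gap (L : R) (c : 'rV[R]_d) (k : 'I_d) : R :=
  sel (c + L *: delta_mx 0 k) 0 k - sel (c - L *: delta_mx 0 k) 0 k.

Lemma slope_gap_ge0 L c k : 0 < L -> 0 <= slope_gap L c k.
Proof.
move=> L0; have := subgrad_monotone (selP (c + L *: delta_mx 0 k))
  (selP (c - L *: delta_mx 0 k)).
have -> : c + L *: delta_mx 0 k - (c - L *: delta_mx 0 k) =
    (2 * L) *: delta_mx 0 k.
  by rewrite opprB addrC addrA subrK -scalerDl; congr (_ *: _); ring.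
rewrite dotZl dotC dot_delta !mxE -/(slope_gap L c k) pmulr_rge0//.
by rewrite mulr_gt0.
Qed.

(** A big jump [y - y'] of the subdifferential inside the ball of radius [r]
    forces the second difference of [phi] at the centre, along the coordinate
    axis best aligned with the jump, to be of order [L * enorm (y - y')]: the
    affine functions with slopes [y] and [y'] bound [phi] from below on both
    sides, up to an error [2 * r * osc], absorbed since [r] is small against
    [L]. *)
Lemma osc_le_slope_gap (L : R) c (r : R) : (0 < d)%N -> 0 < L -> 0 <= r ->
  18 * (Num.sqrt d%:R * r) <= 5 * L ->
  4 * osc c r <= 9 * (Num.sqrt d%:R * \sum_k slope_gap L c k).
Proof.
move=> d0 L0 r0 rL; set D := \sum_k _; set s := Num.sqrt d%:R in rL *.
have s0 : 0 <= s := sqrtr_ge0 _.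
suff : osc c r <= s * D + 5 / 9 * osc c r by lra.
apply: osc_le => // x1 y1 x2 y2 xy1 xy2 x1r x2r.
have [k kP] := exists_coord_ge (y1 - y2) d0.
(* Exchanging the two points changes the sign of the jump. *)
wlog pos : x1 y1 x2 y2 xy1 xy2 x1r x2r kP / 0 <= (y1 - y2) 0 k.
  move=> h; have [|neg] := leP 0 ((y1 - y2) 0 k); first exact: (h x1 y1 x2 y2).
  rewrite enormB; apply: (h x2 y2 x1 y1) => //.
    by rewrite enormB (le_trans kP)// -normrN !mxE opprB.
  by move: neg; rewrite !mxE; lra.
rewrite ger0_norm// -/s in kP.
have kD : slope_gap L c k <= D.
  by rewrite /D (bigD1 k)//= lerDl sumr_ge0// => j _; exact: slope_gap_ge0.
pose e : 'rV[R]_d := delta_mx 0 k.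
have [yc [_ ec]] : exists y, subgrad c y by exists (sel c).
have near x y : subgrad x y -> enorm (x - c) <= r ->
    - (r * osc c r) <= dot (c - x) (y - sel c).
  move=> xy xr; rewrite lerNl -dotNl opprB.
  apply: (le_trans (dot_le_enorm _ _)); apply: ler_pM => //; try exact: enorm_ge0.
  by apply: (le_osc xy (selP c)) => //; rewrite subrr enorm0.
have n1 := near _ _ xy1 x1r; have n2 := near _ _ xy2 x2r.
have up := subgrad_le c (selP (c + L *: e)).
have dn := subgrad_le c (selP (c - L *: e)).
have l1 := subgrad_le (c + L *: e) xy1.
have l2 := subgrad_le (c - L *: e) xy2.
have c1 := subgrad_le x1 (selP c).
have c2 := subgrad_le x2 (selP c).
have : L * (y1 - y2) 0 k <= L * slope_gap L c k + 2 * r * osc c r.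
  move: n1 n2 up dn l1 l2 c1 c2; rewrite /slope_gap -/e.
  rewrite !(dotDl, dotNl, dotBr, dotZl) !(dotC e) !dot_delta !mxE /e.
  lra.
have o0 : 0 <= osc c r := osc_ge0 c r0.
move=> main; apply: (le_trans kP); rewrite -(ler_pM2l L0).
apply: (@le_trans _ _ (s * (L * D + 2 * r * osc c r))).
  rewrite mulrCA; apply: ler_wpM2l => //; apply: (le_trans main).
  by rewrite lerD2r ler_wpM2l// ltW.
have := ler_wpM2r o0 rL; nra.
Qed.

End contact.

(** * Counting the columns of a grid that meet a ball *)

Section counting.
Context {R : realType}.

Lemma expR1_le3 : expR 1 <= 3 :> R.
Proof.
have h : (7 / 8) ^+ 8 <= expR (- 1) :> R.
  have -> : -1 = 8%:R * (- 8^-1) :> R by field.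
  rewrite expRM_natl lerXn2r ?nnegrE ?expR_ge0 ?divr_ge0//.
  by apply: le_trans (expR_ge1Dx _); lra.
have h3 : 3^-1 <= expR (- 1) :> R by apply: le_trans h; lra.
by rewrite -[expR 1]invrK -expRN -[leRHS]invrK lef_pV2 ?posrE ?expR_gt0.
Qed.

Lemma sum_geometric_le (x A : R) K : 0 <= x -> 0 <= A -> x * (1 + A) <= A ->
  \sum_(j < K.*2.+1) x ^+ ((j - K) + (K - j)) <= 1 + 2 * A.
Proof.
move=> x0 A0 xA; apply: (@le_trans _ _ (1 + 2 * A * (1 - x ^+ K))); last first.
  by have := mulr_ge0 A0 (exprn_ge0 K x0); lra.
elim: K => [|K IH]; first by rewrite big_ord1 subnn addn0 expr0; lra.
rewrite doubleS big_ord_recr big_ord_recl /=.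
have -> : \sum_(i < K.*2.+1) x ^+ ((bump 0 i - K.+1) + (K.+1 - bump 0 i)) =
    \sum_(j < K.*2.+1) x ^+ ((j - K) + (K - j)).
  by apply: eq_bigr => i _; rewrite /bump add1n !subSS.
have -> : (K.*2.+2 - K.+1 + (K.+1 - K.*2.+2) = K.+1)%N by lia.
rewrite sub0n subn0 add0n exprS.
have := ler_wpM2r (exprn_ge0 K x0) xA; nra.
Qed.

(** Exponential Markov inequality on the product: weighting each cell by
    [exp (- l1 distance / A)] turns the constrained count into a product of
    geometric series. *)
Lemma card_columns_le (n K : nat) (k : 'I_n.+1) (A : R) : 0 < A ->
  #|[set m : {ffun 'I_n.+1 -> 'I_K.*2.+1} | (m k == ord0) &&
     (\sum_(i | i != k) `|(m i)%:R - K%:R| <= n%:R * A)]%SET|%:R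
  <= (3 * (1 + 2 * A)) ^+ n.
Proof.
move=> A0; set S := [set _ | _]%SET; pose x := expR (- A^-1).
pose F i (j : 'I_K.*2.+1) : R := if i == k then (j == ord0)%:R
  else x ^+ ((j - K) + (K - j)).
have F0 i j : 0 <= F i j by rewrite /F; case: ifP => // _; rewrite exprn_ge0// expR_ge0.
have dist (j : 'I_K.*2.+1) : ((j - K) + (K - j))%:R = `|j%:R - K%:R| :> R.
  have [jK|jK] := leqP j K.
    by rewrite (eqP jK) add0n natrB// distrC ger0_norm// subr_ge0 ler_nat.
  by rewrite natrD natrB ?(ltnW jK)// (eqP (ltnW jK)) addr0 ger0_norm// subr_ge0 ler_nat ltnW.
apply: (@le_trans _ _ (\sum_(m in S) (3 ^+ n * \prod_i F i (m i)))).
  rewrite -sum1_card natr_sum ler_sum// => m; rewrite inE => /andP[mk mS].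
  rewrite (bigD1 k)//= {1}/F eqxx mk mul1r.
  have -> : \prod_(i < n.+1 | i != k) F i (m i) =
      expR (- (A^-1 * \sum_(i | i != k) `|(m i)%:R - K%:R|)).
    rewrite mulr_sumr -sumrN expR_sum; apply: eq_bigr => i ik.
    by rewrite /F (negbTE ik) -expRM_natl dist mulrN mulrC.
  apply: (@le_trans _ _ (expR n%:R * expR (- n%:R))).
    by rewrite -expRD subrr expR0.
  apply: ler_pM; rewrite ?expR_ge0//.
    by rewrite -[n%:R]mulr1 expRM_natl lerXn2r ?nnegrE ?expR_ge0// expR1_le3.
  by rewrite ler_expR lerN2 mulrC ler_pdivrMr.
rewrite -mulr_sumr exprMn; apply: ler_wpM2l; first exact: exprn_ge0.
apply: (@le_trans _ _ (\sum_(m : {ffun 'I_n.+1 -> 'I_K.*2.+1}) \prod_i F i (m i))).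
  rewrite [leRHS](bigID (mem S))/= lerDl sumr_ge0// => m _.
  by rewrite prodr_ge0.
rewrite -bigA_distr_bigA (bigD1 k)//=.
have -> : \sum_(j < K.*2.+1) F k j = 1.
  rewrite (bigD1 ord0)//= big1 ?addr0; first by rewrite /F !eqxx.
  by move=> j j0; rewrite /F eqxx (negbTE j0).
have cardk : #|[set i | i != k]%SET| = n.
  transitivity #|[set~ k]%SET|; last by rewrite cardsC1 card_ord.
  by apply: eq_card => i; rewrite !inE.
have -> : (1 + 2 * A) ^+ n = \prod_(i < n.+1 | i != k) (1 + 2 * A).
  transitivity ((1 + 2 * A) ^+ #|[set i | i != k]%SET|); first by rewrite cardk.
  by rewrite -prodr_const; apply: eq_bigl => i; rewrite inE.
rewrite mul1r; apply: ler_prod => i ik; rewrite sumr_ge0//=.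
under eq_bigr do rewrite /F (negbTE ik).
apply: sum_geometric_le; [exact: expR_ge0|exact: ltW|].
rewrite /x expRN mulrC ler_pdivrMr ?expR_gt0// mulrC -ler_pdivrMr//.
rewrite mulrDl mul1r divff ?gt_eqF// addrC.
exact: expR_ge1Dx.
Qed.

End counting.

(** * Total oscillation of a monotone graph over a grid *)

Section window.
Context {R : realType}.

(** A shift by [h] is made of [h] unit shifts, and the sum over a window of the
    increments of one unit shift telescopes to a single difference. *)
Lemma window_sum_le (G : nat -> R) (D : R) (n h : nat) :
  (forall i j, G i - G j <= D) ->
  \sum_(j < n) (G (j + h)%N - G j) <= h%:R * D.
Proof.
move=> GD; elim: h => [|h IH].
  by rewrite mul0r big1// => j _; rewrite addn0 subrr.
have -> : \sum_(j < n) (G (j + h.+1)%N - G j) =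
    \sum_(j < n) (G (j + h)%N - G j) +
    \sum_(0 <= j < n) (G (j.+1 + h)%N - G (j + h)%N).
  rewrite big_mkord -big_split; apply: eq_bigr => j _ /=.
  by rewrite addSnnS; ring.
rewrite (telescope_sumr (fun j => G (j + h)%N))// -natr1 mulrDl mul1r.
by rewrite lerD.
Qed.

End window.

Section grid.
Context {R : realType} {d : nat}.
Variables (o : 'rV[R]_d) (l : R) (K : nat).
Local Notation I := {ffun 'I_d -> 'I_K.*2.+1}.

(** Indices are shifted by [K], so that the middle cell is centred at [o]. *)
Definition cell_center (m : I) : 'rV[R]_d :=
  \row_i (o 0 i + l * ((m i)%:R - K%:R)).

Definition set_coord (m : I) k j : I := [ffun i => if i == k then j else m i].

Lemma sum_columns (k : 'I_d) (P : pred I) (f : I -> R) (B : R) :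
  (forall m j, P (set_coord m k j) = P m) ->
  (forall m, P m -> \sum_j f (set_coord m k j) <= B) ->
  \sum_(m | P m) f m <= #|[set m : I | (m k == ord0) && P m]%SET|%:R * B.
Proof.
move=> Pk fB.
rewrite (partition_big (fun m : I => set_coord m k ord0)
  (mem [set m : I | (m k == ord0) && P m]%SET)) /=; last first.
  by move=> m Pm; rewrite inE Pk Pm ffunE eqxx eqxx.
rewrite -sum1_card natr_sum mulr_suml ler_sum// => m0.
rewrite inE => /andP[m0k Pm0]; rewrite mul1r.
rewrite (reindex_onto (set_coord m0 k) (fun m : I => m k)) /=; last first.
  move=> m /andP[_ /eqP <-]; apply/ffunP => i; rewrite !ffunE.
  by case: eqP => [->|].
rewrite (eq_bigl xpredT); first exact: fB.
move=> j; rewrite Pk Pm0 [set_coord m0 k j k]ffunE eqxx eqxx andbT /=.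
apply/eqP/ffunP => i; rewrite !ffunE; case: eqP => // ->.
by rewrite (eqP m0k).
Qed.

Variables (Y : set 'rV[R]_d) (phi psi : 'rV[R]_d -> R) (sel : 'rV[R]_d -> 'rV[R]_d).
Hypothesis compact_Y : compact Y.
Hypothesis conj : conjugate Y phi psi.
Hypothesis selP : forall z, subgrad Y phi psi z (sel z).

(** The slope gaps at the cells of a column are the increments, over [J.*2]
    cells, of one sequence of [k]-th coordinates of points of [Y]. *)
Lemma column_slope_gap_le (J : nat) m k :
  \sum_j slope_gap sel (J%:R * l) (cell_center (set_coord m k j)) k
  <= J.*2%:R * diam Y.
Proof.
pose q (i : nat) := cell_center (set_coord m k ord0)
  + (l * (i%:R - J%:R)) *: delta_mx 0 k.
apply: le_trans (@window_sum_le R (fun i => sel (q i) 0 k) _ K.*2.+1 _ _).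
  apply: ler_sum => j _; rewrite /slope_gap le_eqVlt; apply/orP; left; apply/eqP.
  congr (sel _ 0 k - sel _ 0 k); apply/rowP => i; rewrite !mxE !ffunE eqxx /=;
    case: (i == k); rewrite /= -?(addnn J) ?natrD; ring.
move=> i j; have -> : sel (q i) 0 k - sel (q j) 0 k = (sel (q i) - sel (q j)) 0 k.
  by rewrite !mxE.
apply: (le_trans (ler_norm _)); apply: (le_trans (coord_le_enorm _ _)).
by apply: le_diam => //; [case: (selP (q i))|case: (selP (q j))].
Qed.

End grid.

Section grid_osc.
Context {R : realType} {n : nat}.
Variables (X Y : set 'rV[R]_n.+1) (phi psi : 'rV[R]_n.+1 -> R).
Hypothesis compact_X : compact X.
Hypothesis compact_Y : compact Y.
Hypothesis conj : conjugate Y phi psi.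
Variables (o : 'rV[R]_n.+1) (K : nat) (s : R).
Hypothesis Xo : X o.
Hypothesis DX0 : 0 < diam X.
Hypothesis n_gt0 : (0 < n)%N.
Hypothesis s_gt0 : 0 < s.
Hypothesis s_small : 144 * s <= 1.
Local Notation d := n.+1.
Local Notation eta := (s * diam X).
Local Notation I := {ffun 'I_n.+1 -> 'I_K.*2.+1}.

(** Half the diagonal of a cell is [9/10 * eta]. *)
Definition mesh : R := 9 / 5 * eta / Num.sqrt d%:R.

Lemma mesh_gt0 : 0 < mesh.
Proof. by rewrite divr_gt0 ?sqrtr_gt0 ?ltr0n//; have := mulr_gt0 s_gt0 DX0; lra. Qed.

Local Notation center := (cell_center o mesh).

Definition in_cell (m : I) (x : 'rV[R]_n.+1) :=
  forall i, `|x 0 i - center m 0 i| <= mesh / 2.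

Lemma in_cell_dist m x : in_cell m x -> enorm (x - center m) <= 9 / 10 * eta.
Proof.
move=> xm; apply: (@le_trans _ _ (Num.sqrt d%:R * (mesh / 2))).
  apply: enorm_le_coord => [|i]; first by rewrite divr_ge0// ltW// mesh_gt0.
  by have := xm i; rewrite !mxE.
rewrite /mesh le_eqVlt; apply/orP; left; apply/eqP.
by field; rewrite sqrtr_eq0 -ltNge ltr0n.
Qed.

(** The [l1] size of the index is controlled through its Euclidean size, using
    [u <= (u ^+ 2 / A + A) / 2] with [A] just above the bound for the
    quadratic mean of [n] coordinates: [393 / 500] exceeds [5 / 9] times the
    square root of [2]. *)
Lemma cell_index_le m x k : X x -> in_cell m x ->
  \sum_(i | i != k) `|(m i)%:R - K%:R| <= n%:R * (393 / 500 * (s^-1 + 1)).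
Proof.
move=> Xx xm; set A := 393 / 500 * (s^-1 + 1).
have si0 : 0 < s^-1 by rewrite invr_gt0.
have A0 : 0 < A by rewrite /A; lra.
have co : enorm (center m - o) <= (1 + s) * diam X.
  apply: (le_trans (enorm_triangle x _ _)); rewrite enormB.
  have := in_cell_dist xm; have := le_diam compact_X Xx Xo.
  have := mulr_gt0 s_gt0 DX0; lra.
have sq : \sum_(i < d) ((m i)%:R - K%:R) ^+ 2 <= 2 * n%:R * (25 / 81 * (s^-1 + 1) ^+ 2) :> R.
  have : mesh ^+ 2 * (\sum_(i < d) ((m i)%:R - K%:R) ^+ 2) <= ((1 + s) * diam X) ^+ 2.
    apply: (@le_trans _ _ (enorm (center m - o) ^+ 2)); last first.
      by rewrite lerXn2r ?nnegrE ?enorm_ge0//; apply: le_trans co; exact: enorm_ge0.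
    rewrite enorm_sqr mulr_sumr /dot ler_sum// => i _; rewrite !mxE.
    by rewrite -expr2 addrAC subrr add0r [in leRHS]exprMn.
  rewrite mulrC -ler_pdivlMr ?exprn_gt0 ?mesh_gt0// => /le_trans; apply.
  rewrite /mesh expr_div_n sqr_sqrtr//.
  have -> : ((1 + s) * diam X) ^+ 2 / ((9 / 5 * eta) ^+ 2 / d%:R) =
      d%:R * (25 / 81 * (s^-1 + 1) ^+ 2).
    by field; rewrite !gt_eqF.
  apply: ler_wpM2r; first by rewrite mulr_ge0// sqr_ge0.
  by rewrite -natrM ler_nat; lia.
apply: (@le_trans _ _ (\sum_(i < d | i != k) (((m i)%:R - K%:R) ^+ 2 / A + A) / 2)).
  apply: ler_sum => i _; set u := _ - _; rewrite -[u ^+ 2]real_normK ?num_real//.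
  have : 0 <= (`|u| - A) ^+ 2 / A by rewrite divr_ge0 ?sqr_ge0 ?ltW.
  have -> : (`|u| - A) ^+ 2 / A = `|u| ^+ 2 / A - 2 * `|u| + A by field; rewrite gt_eqF.
  lra.
rewrite -mulr_suml big_split/= -mulr_suml.
have -> : \sum_(i < d | i != k) A = n%:R * A.
  rewrite sumr_const mulr_natl; congr (_ *+ _).
  by have := cardC1 k; rewrite card_ord /= => ->.
set T := \sum_(i < d | _) _.
have TA : T <= n%:R * A ^+ 2.
  apply: (@le_trans _ _ (\sum_(i < d) ((m i)%:R - K%:R) ^+ 2)).
    by rewrite /T [leRHS](bigID (fun i => i != k))/= lerDl sumr_ge0// => i _; exact: sqr_ge0.
  apply: (le_trans sq); rewrite -mulrA mulrCA; apply: ler_wpM2l => //.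
  rewrite /A exprMn; have := sqr_ge0 (s^-1 + 1); lra.
have : T / A <= n%:R * A by rewrite ler_pdivrMr// -mulrA -expr2.
lra.
Qed.

(** Each oscillation is bounded by a sum of slope gaps, and for each axis the
    gaps are summed column by column. The columns number [s^-1 ^+ n] up to a
    constant, one power less than the cells, and each contributes at most a
    multiple of [diam Y]. *)
Lemma grid_osc_le :
  \sum_(m : I | `[< exists2 x, X x & in_cell m x >]) osc Y phi psi (center m) (2 * eta)
  <= 18 * Num.sqrt d%:R * d%:R ^+ 2 * (24 / 5 / s) ^+ n * diam Y.
Proof.
have [sel selP] : {sel | forall z, subgrad Y phi psi z (sel z)}.
  have h z : {y | subgrad Y phi psi z y}.
    by apply: cid; have [y ? ?] := conj.2 z; exists y.
  by exists (fun z => projT1 (h z)) => z; exact: projT2 (h z).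
have e0 : 0 < eta := mulr_gt0 s_gt0 DX0.
have sd0 : 0 < Num.sqrt d%:R :> R by rewrite sqrtr_gt0 ltr0n.
have sd2 : Num.sqrt d%:R * Num.sqrt d%:R = d%:R :> R by rewrite -expr2 sqr_sqrtr.
(* The telescoping requires [L] to be a whole number of cells; with [4 * d]
   of them the smallness condition of [osc_le_slope_gap] for the radius
   [2 * eta] is an equality. *)
pose J := (4 * d)%N; pose L := J%:R * mesh.
have LE : L = 36 / 5 * eta * Num.sqrt d%:R.
  rewrite /L /mesh /J natrM; set r := Num.sqrt _ in sd0 sd2 *.
  by rewrite -sd2; field; exact/lt0r_neq0.
have L0 : 0 < L by rewrite LE !mulr_gt0.
have DY0 : 0 <= diam Y by case: (selP 0) => Yy _; exact: diam_ge0 Yy.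
pose A := 393 / 500 * (s^-1 + 1).
have si : 144 <= s^-1 by rewrite -[144]invrK lef_pV2 ?posrE ?invr_gt0// -[_^-1]mul1r ler_pdivlMr// mulrC.
have A0 : 0 < A by rewrite /A; lra.
pose Pk k (m : I) := \sum_(i | i != k) `|(m i)%:R - K%:R| <= n%:R * A.
have col k : \sum_(m : I | Pk k m) slope_gap sel L (center m) k <=
    (24 / 5 / s) ^+ n * (J.*2%:R * diam Y).
  apply: (le_trans (@sum_columns R _ K k (Pk k) _ (J.*2%:R * diam Y) _ _)).
  - move=> m j; rewrite /Pk; congr (_ <= _); apply: eq_bigr => i ik.
    by rewrite ffunE (negbTE ik).
  - by move=> m _; exact: column_slope_gap_le.
  apply: ler_wpM2r; first by rewrite mulr_ge0.
  apply: (le_trans (@card_columns_le R n K k A A0)).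
  have lo : 0 <= 3 * (1 + 2 * A) by lra.
  have up : 3 * (1 + 2 * A) <= 24 / 5 / s by rewrite /A; lra.
  by rewrite lerXn2r ?nnegrE// (le_trans lo up).
have osc_gap (m : I) : 4 * osc Y phi psi (center m) (2 * eta) <=
    9 * (Num.sqrt d%:R * \sum_k slope_gap sel L (center m) k).
  apply: (osc_le_slope_gap conj compact_Y selP) => //; first by rewrite mulr_ge0// ltW.
  rewrite LE; lra.
have gap0 k (m : I) : 0 <= slope_gap sel L (center m) k := slope_gap_ge0 conj selP (center m) k L0.
apply: (@le_trans _ _ (\sum_(m : I | `[< exists2 x, X x & in_cell m x >])
    9 / 4 * (Num.sqrt d%:R * \sum_k slope_gap sel L (center m) k))).
  by apply: ler_sum => m _; have := osc_gap m; lra.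
rewrite -mulr_sumr -mulr_sumr exchange_big/=.
apply: (@le_trans _ _ (9 / 4 * (Num.sqrt d%:R *
    \sum_(k < d) ((24 / 5 / s) ^+ n * (J.*2%:R * diam Y))))).
  rewrite ler_pM2l ?ler_pM2l//; apply: ler_sum => k _; apply: le_trans (col k).
  rewrite [leRHS](bigID (fun m => `[< exists2 x, X x & in_cell m x >]))/=.
  rewrite -[leLHS]addr0 lerD ?sumr_ge0//.
  rewrite le_eqVlt; apply/orP; left; apply/eqP; apply: eq_bigl => m.
  apply/idP/andP => [/[dup] /asboolP[x Xx xm] ? |[]//]; split=> //.
  exact: cell_index_le Xx xm.
rewrite sumr_const card_ord -(mulr_natl (_ * _)) /J -muln2 !natrM le_eqVlt; apply/orP; left; apply/eqP.
by set u := (_ / s) ^+ n; field.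
Qed.

End grid_osc.

(** * Volumes of Euclidean balls *)

Section scaling.
Context {R : realType}.
Local Notation mu := (@lebesgue_measure R).

(** [mu] and [A |-> r * mu (r^-1 A)] agree on intervals, hence coincide. *)
Lemma ge0_integral_lebesgue_scale (r : R) (f : R -> \bar R) : 0 < r ->
  measurable_fun [set: R] f -> (forall t, (0 <= f t)%E) ->
  (\int[mu]_t f t = r%:E * \int[mu]_t f (r * t)%R)%E.
Proof.
move=> r0 mf f0.
have mr : measurable_fun [set: measurableTypeR R]
    (fun t : measurableTypeR R => r * t : measurableTypeR R).
  exact: measurable_funM.
pose rr : {nonneg R} := NngNum (ltW r0).
pose pushed : {measure set (measurableTypeR R) -> \bar R} :=
  pushforward mu (fun t : R => r * t : measurableTypeR R).
pose nu : {measure set (measurableTypeR R) -> \bar R} := mscale rr (pushed mr).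
have nuE (A : set R) : measurable A -> mu A = nu A.
  move=> mA; apply: (@lebesgue_measure_unique R nu) => // _ [[a b]] _ <-.
  rewrite /nu/= /mscale/= /pushforward.
  have -> : (fun t : R => r * t) @^-1` `]a, b]%classic = `]a / r, b / r]%classic.
    apply/seteqP; split=> t /=; rewrite !in_itv/= ltr_pdivrMr// ler_pdivlMr//;
      by rewrite mulrC.
  rewrite !lebesgue_measure_itv/= !lte_fin ltr_pM2r ?invr_gt0//.
  case: ifP => _; last by rewrite mule0.
  by rewrite -!EFinB -EFinM -mulrBl mulrCA divff ?gt_eqF// mulr1.
transitivity (\int[nu]_t f t)%E.
  by apply: eq_measure_integral => A mA _; exact: nuE.
rewrite ge0_integral_mscale//=; congr (_ * _)%E.
rewrite -[in RHS](preimage_setT (fun t : R => r * t)).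
by apply: (ge0_integral_pushforward mr mu (D := setT) (f := f)).
Qed.

End scaling.

Section ball_volume.
Context {R : realType}.
Local Notation mu := (@lebesgue_measure R).

Lemma volume0 k : volume (set0 : set 'rV[R]_k) = 0%E.
Proof.
elim: k => [|k IH] /=; first by rewrite indic0.
by rewrite (eq_integral (cst 0%E)) ?integral0// => t _; exact: IH.
Qed.

Lemma enorm_row_mx k (t : R) (v : 'rV[R]_k) :
  enorm (row_mx (const_mx t : 'rV[R]_1) v : 'rV[R]_k.+1) ^+ 2 = t ^+ 2 + enorm v ^+ 2.
Proof.
pose x : 'rV[R]_k.+1 := row_mx (const_mx t : 'rV[R]_1) v; rewrite -/x.
have x0 : x 0 ord0 = t.
  have := row_mxEl (const_mx t : 'rV[R]_1) v 0 ord0; rewrite [X in _ = X -> _]mxE => <-.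
  by congr (row_mx _ _ _ _); apply: val_inj.
have xS i : x 0 (lift ord0 i) = v 0 i.
  have := row_mxEr (const_mx t : 'rV[R]_1) v 0 i => <-.
  by congr (row_mx _ _ _ _); apply: val_inj.
rewrite !enorm_sqr /dot big_ord_recl x0 -expr2; congr (_ + _).
by apply: eq_bigr => i _; rewrite xS.
Qed.

Lemma eball_section k (r t : R) : 0 < r ->
  [set v : 'rV[R]_k | eball (0 : 'rV[R]_k.+1) r (row_mx (const_mx t : 'rV[R]_1) v)] =
  if `|t| < r then eball 0 (Num.sqrt (r ^+ 2 - t ^+ 2)) else set0.
Proof.
move=> r0; have E v : eball (0 : 'rV[R]_k.+1) r (row_mx (const_mx t : 'rV[R]_1) v) <->
    t ^+ 2 + enorm v ^+ 2 < r ^+ 2.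
  rewrite /eball /= subr0 -(@ltr_pXn2r _ 2)// ?nnegrE ?enorm_ge0 ?ltW//.
  by rewrite enorm_row_mx.
have tr : (`|t| < r) = (t ^+ 2 < r ^+ 2).
  by rewrite -(@ltr_pXn2r _ 2)// ?nnegrE ?ltW// real_normK ?num_real.
rewrite tr; case: ifPn => h; apply/seteqP; split=> v /=; rewrite ?E.
- rewrite /eball /= subr0 => hv; rewrite -(@ltr_pXn2r _ 2)// ?nnegrE ?enorm_ge0 ?sqrtr_ge0//.
  by rewrite [X in _ < X]sqr_sqrtr ?subr_ge0 ?ltW//; lra.
- rewrite /eball /= subr0 -(@ltr_pXn2r _ 2)// ?nnegrE ?enorm_ge0 ?sqrtr_ge0//.
  by rewrite [X in _ < X]sqr_sqrtr ?subr_ge0 ?ltW//; lra.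
- by move=> hv; move: h; rewrite -leNgt; have := sqr_ge0 (enorm v); lra.
- by [].
Qed.

(** Up to the factor [beta k], the [k]-dimensional volume of the section of a
    ball of radius [r] at height [t]. *)
Definition slice (k : nat) (r t : R) : R :=
  \1_(`]-r, r[%classic : set R) t * Num.sqrt (r ^+ 2 - t ^+ 2) ^+ k.

Lemma slice_ge0 k r t : 0 <= slice k r t.
Proof. by rewrite mulr_ge0// exprn_ge0// sqrtr_ge0. Qed.

Lemma measurable_slice k r : measurable_fun [set: R] (slice k r).
Proof.
apply: measurable_funM; first exact: measurable_indic.
apply: measurable_funX.
apply: (measurableT_comp (continuous_measurable_fun (@sqrt_continuous R))).
by apply: measurable_funB => //; exact: measurable_funX.
Qed.

Lemma slice_scale k r t : 0 < r -> slice k r (r * t) = r ^+ k * slice k 1 t.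
Proof.
move=> r0; rewrite /slice !indicE mulrCA; congr (_ * _).
  rewrite !mem_setE !in_itv /= -mulrN1 ltr_pM2l// gtr_pMr//.
have -> : r ^+ 2 - (r * t) ^+ 2 = r ^+ 2 * (1 ^+ 2 - t ^+ 2) by ring.
by rewrite sqrtrM ?sqr_ge0// sqrtr_sqr gtr0_norm// exprMn.
Qed.

Definition slice_mass k : \bar R := (\int[mu]_t (slice k 1 t)%:E)%E.

(** Slices of a ball are balls of one dimension less. *)
Lemma volume_ball_rec k b : 0 <= b ->
  (forall r : R, 0 < r -> volume (eball (0 : 'rV[R]_k) r) = (r ^+ k * b)%:E) ->
  forall r : R, 0 < r -> volume (eball (0 : 'rV[R]_k.+1) r) =
    ((r ^+ k.+1 * b)%:E * slice_mass k)%E.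
Proof.
move=> b0 vb r r0 /=.
have pt t : volume [set v : 'rV[R]_k | eball (0 : 'rV[R]_k.+1) r
    (row_mx (const_mx t : 'rV[R]_1) v)] = (b%:E * (slice k r t)%:E)%E.
  rewrite eball_section// /slice indicE mem_setE in_itv/= -ltr_norml.
  case: ifPn => tr; last by rewrite volume0 mul0r mule0.
  rewrite mul1r vb; first by rewrite EFinM muleC.
  rewrite sqrtr_gt0 subr_gt0.
  by rewrite -(real_normK (num_real t)) ltr_pXn2r// nnegrE ltW.
under eq_integral do rewrite pt.
rewrite ge0_integralZl//; last 2 first.
- by apply/measurable_EFinP; exact: measurable_slice.
- by move=> t _; rewrite lee_fin slice_ge0.
rewrite (ge0_integral_lebesgue_scale r0); last 2 first.
- by apply/measurable_EFinP; exact: measurable_slice.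
- by move=> t; rewrite lee_fin slice_ge0.
under eq_integral do rewrite slice_scale// EFinM.
rewrite ge0_integralZl//; last 3 first.
- by apply/measurable_EFinP; exact: measurable_slice.
- by move=> t _; rewrite lee_fin slice_ge0.
- by rewrite lee_fin exprn_ge0// ltW.
by rewrite -/(slice_mass k) !muleA -!EFinM exprS; congr (_%:E * _)%E; ring.
Qed.

Lemma bernoulli_subr k (v : R) : 0 <= v -> v <= 1 -> 1 - k%:R * v <= (1 - v) ^+ k.
Proof.
move=> v0 v1; elim: k => [|k IH]; first by rewrite expr0 mul0r subr0.
have u0 : 0 <= 1 - v by lra.
rewrite exprS -natr1; apply: le_trans (ler_wpM2l u0 IH).
have : 0 <= k%:R * v ^+ 2 by rewrite mulr_ge0// sqr_ge0.
lra.
Qed.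

(** Only the heights up to [tau] are kept; there
    [(1 - t ^+ 2) ^+ k] bounds the integrand below, and Bernoulli's inequality
    applies. *)
Lemma slice_mass_ge k (tau : R) : 0 < tau -> tau < 1 ->
  ((2 * tau * (1 - k%:R * tau ^+ 2))%:E <= slice_mass k)%E.
Proof.
move=> t0 t1; have t2 : tau ^+ 2 <= 1 by rewrite expr_le1// ltW.
have [neg|pos] := leP (1 - k%:R * tau ^+ 2) 0.
  apply: (@le_trans _ _ 0%E); last by apply: integral_ge0 => t _; rewrite lee_fin slice_ge0.
  by rewrite lee_fin mulr_ge0_le0// mulr_ge0// ltW.
apply: (@le_trans _ _ (\int[mu]_(t in `[(- tau)%R, tau]) (cst (1 - k%:R * tau ^+ 2)%:E t))%E).
  rewrite integral_cst//= lebesgue_measure_itv/= lte_fin ifT; last lra.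
  by rewrite -EFinB -EFinM lee_fin; lra.
rewrite /slice_mass integral_mkcond; apply: ge0_le_integral => //.
- by move=> t _; rewrite patchE; case: ifP => // _; rewrite lee_fin ltW.
- by apply/(measurable_restrictT _ _).1 => //; exact: measurable_cst.
- by apply/measurable_EFinP; exact: measurable_slice.
move=> t _; rewrite patchE; case: ifPn => [|_]; last by rewrite lee_fin slice_ge0.
rewrite mem_setE in_itv/= -ler_norml => tt; rewrite lee_fin /slice indicE mem_setE.
rewrite in_itv/= -ltr_norml (le_lt_trans tt)// mul1r expr1n.
have tt2 : t ^+ 2 <= tau ^+ 2.
  by rewrite -(real_normK (num_real t)) lerXn2r// nnegrE ltW.
set u := 1 - t ^+ 2; have u0 : 0 <= u by rewrite /u; lra.
have u1 : u <= 1 by rewrite /u; have := sqr_ge0 t; lra.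
have su : u <= Num.sqrt u.
  rewrite -(@ler_pXn2r _ 2)// ?nnegrE ?sqrtr_ge0// sqr_sqrtr//.
  by rewrite expr2 ler_piMl.
apply: (@le_trans _ _ (u ^+ k)); last by rewrite lerXn2r ?nnegrE ?sqrtr_ge0.
apply: (@le_trans _ _ (1 - k%:R * t ^+ 2)).
  by rewrite lerD2l lerN2 ler_wpM2l.
by apply: bernoulli_subr; rewrite ?sqr_ge0//; lra.
Qed.

Lemma slice_mass_le k : (slice_mass k <= 2%:E)%E.
Proof.
apply: (@le_trans _ _ (\int[mu]_t (\1_(`[-1, 1]%classic : set R) t)%:E)%E).
  apply: ge0_le_integral => //.
  - by move=> t _; rewrite lee_fin slice_ge0.
  - by apply/measurable_EFinP; exact: measurable_slice.
  - by apply/measurable_EFinP; exact: measurable_indic.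
  move=> t _; rewrite lee_fin /slice !indicE !mem_setE !in_itv/=.
  have [/andP[h1 h2]|_] := boolP ((-1 < t) && (t < 1)); last by rewrite mul0r.
  rewrite (ltW h1) (ltW h2) mul1r expr1n exprn_ile1 ?sqrtr_ge0//.
  by rewrite -[leRHS]sqrtr1 ler_wsqrtr//; have := sqr_ge0 t; lra.
rewrite integral_indic//= setIT lebesgue_measure_itv/= lte_fin ifT; last lra.
by rewrite -EFinB lee_fin; lra.
Qed.

(** The sections of a ball being balls, the volume of the unit ball is a product
    of slice masses, and these are finite and positive. *)
Lemma volume_ball k : 0 < beta R k /\ forall r : R, 0 < r ->
  volume (eball (0 : 'rV[R]_k) r) = (r ^+ k * beta R k)%:E.
Proof.
suff [b b0 vb] : exists2 b : R, 0 < b & forall r : R, 0 < r ->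
    volume (eball (0 : 'rV[R]_k) r) = (r ^+ k * b)%:E.
  have -> : beta R k = b by rewrite /beta vb// expr1n mul1r.
  by [].
elim: k => [|k [b b0 IH]].
  exists 1 => // r r0; rewrite /= indicE expr0 mulr1 mem_set//= /eball /=.
  by rewrite subrr enorm0.
have m0 : (0 < slice_mass k)%E.
  have kp : 0 < k.+2%:R :> R by [].
  (* Any [tau < 1] with [k%:R * tau ^+ 2 < 1] would do. *)
  apply: lt_le_trans (@slice_mass_ge k k.+2%:R^-1 _ _); rewrite ?invr_gt0//.
    rewrite lte_fin !mulr_gt0 ?invr_gt0// subr_gt0 exprVn ltr_pdivrMr ?exprn_gt0//.
    by rewrite mul1r -natrX ltr_nat expnS expn1; lia.
  by rewrite invf_lt1// ltr1n.
have mf : slice_mass k \is a fin_num.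
  by rewrite ge0_fin_numE ?ltW// (le_lt_trans (slice_mass_le k))// ltry.
exists (b * fine (slice_mass k)).
  by rewrite mulr_gt0// fine_gt0// m0 ltey_eq mf.
move=> r r0; rewrite (volume_ball_rec (ltW b0) IH r0) -(fineK mf) -EFinM /=.
by rewrite mulrA.
Qed.

(** The bound [slice_mass_ge] with [tau = k.+1%:R^-1]: then
    [k.+1%:R * slice_mass k] is at least [2 * (1 - k / (k + 1) ^ 2)], and
    [4 * k <= (k + 1) ^ 2]. *)
Lemma beta_ratio_ge k : (0 < k)%N ->
  3 / 2 * beta R k <= k.+1%:R * beta R k.+1.
Proof.
move=> k0; have [bk vk] := volume_ball k; have [bk1 vk1] := volume_ball k.+1.
have := volume_ball_rec (ltW bk) vk ltr01; rewrite vk1// !expr1n !mul1r => e.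
have d0 : 0 < k.+1%:R :> R by [].
have : ((beta R k)%:E * (2 * k.+1%:R^-1 * (1 - k%:R * k.+1%:R^-1 ^+ 2))%:E <=
    (beta R k.+1)%:E)%E.
  rewrite e; apply: lee_wpmul2l; first by rewrite lee_fin ltW.
  by apply: slice_mass_ge; rewrite ?invr_gt0// invf_lt1// ltr1n.
rewrite -EFinM lee_fin => h.
apply: le_trans (ler_wpM2l (ltW d0) h).
set x := k%:R * _ ^+ 2.
have x4 : x <= 4^-1.
  rewrite /x exprVn ler_pdivrMr ?exprn_gt0// -[k.+1%:R]natr1.
  have := sqr_ge0 (k%:R - 1 : R); lra.
have -> : k.+1%:R * (beta R k * (2 * k.+1%:R^-1 * (1 - x))) =
   2 * (beta R k * (1 - x)) by field; rewrite gt_eqF.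
nra.
Qed.

End ball_volume.

(** * Measurable partitions into small cells *)

Section cells.
Context {R : realType} {d : nat}.
Local Notation E := (borel_rV R d).
Variables (o : 'rV[R]_d) (l : R) (K : nat).
Hypothesis l0 : 0 < l.

(** The summand [2^-1] rounds to the nearest cell centre; truncating at [0] and at
    [K.*2] keeps the index set finite, by sending the points outside the grid to
    its border. *)
Definition coord_index (a v : R) : nat :=
  minn (Num.trunc ((v - a) / l + K%:R + 2^-1)) K.*2.

Definition cell_index (x : 'rV[R]_d) : {ffun 'I_d -> 'I_K.*2.+1} :=
  [ffun i => inord (coord_index (o 0 i) (x 0 i))].

Lemma coord_index_dist a v : `|v - a| <= l * K%:R ->
  `|v - (a + l * ((coord_index a v)%:R - K%:R))| <= l / 2.
Proof.
move=> va; pose w := (v - a) / l.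
have wK : - K%:R <= w <= K%:R.
  by rewrite -ler_norml /w normrM normfV (gtr0_norm l0) ler_pdivrMr// mulrC.
have w0 : 0 <= w + K%:R + 2^-1 by lra.
have /andP[t1 t2] := truncn_itv w0.
have -> : coord_index a v = Num.trunc (w + K%:R + 2^-1).
  rewrite /coord_index -/w; apply/minn_idPl.
  have KK : K.*2.+1%:R = K%:R + K%:R + 1 :> R by rewrite -addnn -natr1 natrD.
  by rewrite -ltnS truncn_lt_nat// KK; lra.
set t := Num.trunc _ in t1 t2 *.
have -> : v - (a + l * (t%:R - K%:R)) = l * (w - (t%:R - K%:R)).
  by rewrite /w; field; rewrite gt_eqF.
rewrite normrM (gtr0_norm l0) ler_pM2l// ler_norml.
by move: t2; rewrite -[t.+1%:R]natr1; lra.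
Qed.

Lemma cell_index_dist (x : 'rV[R]_d) : (forall i, `|x 0 i - o 0 i| <= l * K%:R) ->
  forall i, `|x 0 i - cell_center o l (cell_index x) 0 i| <= l / 2.
Proof.
move=> xo i; rewrite !mxE ffunE inordK; first exact: coord_index_dist.
by rewrite ltnS geq_minr.
Qed.

Lemma measurable_cell m : measurable (cell_index @^-1` [set m] : set E).
Proof.
pose B i : set E := (fun x : E => (coord_index (o 0 i) ((x : 'rV[R]_d) 0 i))%:R : R) @^-1`
  [set (m i)%:R].
have -> : cell_index @^-1` [set m] = \bigcap_(i in [set: 'I_d]) B i.
  apply/seteqP; split=> [x /= xm i _|x h /=].
    by rewrite /B/= -xm ffunE inordK// ltnS geq_minr.
  apply/ffunP => i; rewrite ffunE; apply: val_inj => /=.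
  have := h i Logic.I; rewrite /B/= => /eqP; rewrite eqr_nat => /eqP <-.
  by rewrite inordK// ltnS geq_minr.
apply: fin_bigcap_measurable => // i _.
rewrite /B -[X in measurable X]setTI.
apply: (measurableT_comp (f := fun v : R => (coord_index (o 0 i) v)%:R : R)
  (g := fun x : E => (x : 'rV[R]_d) 0 i)) => //; last exact: measurable_coord.
apply: nondecreasing_measurable => // v w vw; rewrite ler_nat /coord_index.
rewrite leq_min geq_minr andbT geq_min le_truncn//.
by rewrite !lerD2r ler_wpM2r ?lerD2r// invr_ge0 ltW.
Qed.

End cells.

Lemma fine_partition (R : realType) (d : nat) (X : set 'rV[R]_d) (e : R) :
  compact X -> 0 < e ->
  {I : finType & {kappa : 'rV[R]_d -> I |
    (forall i, measurable (kappa @^-1` [set i] : set (borel_rV R d))) /\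
    (forall x x', X x -> X x' -> kappa x = kappa x' -> enorm (x - x') <= e)}}.
Proof.
move=> cX e0.
have [B XB] : {B | forall x, X x -> enorm x <= B}.
  by apply: cid; have [B _ XB] := compact_enorm_bounded cX; exists B.
have sd1 : 0 < Num.sqrt d%:R + 1 :> R by rewrite ltr_wpDl// sqrtr_ge0.
pose l := e / (Num.sqrt d%:R + 1).
have l0 : 0 < l by rewrite divr_gt0.
pose K := (Num.trunc (`|B| / l)).+1.
exists {ffun 'I_d -> 'I_K.*2.+1}, (cell_index 0 l K); split=> [m|x x' Xx Xx' xx'].
  exact: measurable_cell.
have h z : X z -> forall i, `|z 0 i - cell_center 0 l (cell_index 0 l K z) 0 i| <= l / 2.
  move=> Xz; apply: cell_index_dist => // i; rewrite mxE subr0.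
  apply: (le_trans (coord_le_enorm _ _)); apply: (le_trans (XB z Xz)).
  apply: (le_trans (ler_norm _)); rewrite mulrC -ler_pdivrMr//.
  by apply/ltW; have /andP[] := truncn_itv (divr_ge0 (normr_ge0 B) (ltW l0)).
apply: (@le_trans _ _ (Num.sqrt d%:R * l)); last first.
  by rewrite /l mulrA ler_pdivrMr// mulrC ler_pM2l// lerDl.
apply: enorm_le_coord => [|i]; first exact: ltW.
have := h _ Xx i; have := h _ Xx' i; rewrite -xx' !mxE => h1 h2.
rewrite ler_norml; move: h1 h2; rewrite !ler_norml; lra.
Qed.

(** * Restrictions, marginals and sets of full measure *)

Section restriction.
Context d (T : measurableType d) (R : realType).

Lemma ge0_integral_mrestr (m : {measure set T -> \bar R}) (D : set T)
    (mD : measurable D) (f : T -> \bar R) :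
  measurable_fun setT f -> (forall x, (0 <= f x)%E) ->
  (\int[mrestr m mD]_x f x = \int[m]_(x in D) f x)%E.
Proof.
move=> mf f0; rewrite -(setUv D) ge0_integral_setU//=; last 3 first.
- exact: measurableC.
- by rewrite setUv.
- by rewrite disj_set2E setICr.
rewrite [X in (_ + X)%E](_ : _ = 0%E); last first.
  rewrite (eq_measure_integral (@mzero _ T R)) ?integral_measure_zero//.
  by move=> A _ AD; rewrite /= /mrestr (disjoints_subset A D).2// measure0.
rewrite adde0; apply: eq_measure_integral => A _ AD.
by rewrite /= /mrestr ((setIidPl A D).2 AD).
Qed.

Lemma ae_full (P : probability T R) (A : set T) :
  measurable A -> P A = 1%E -> {ae P, forall x, A x}.
Proof.
move=> mA PA; exists (~` A); split; [exact: measurableC| |exact: subsetC].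
by rewrite probability_setC// PA subee.
Qed.

Lemma full_setI (P : probability T R) (A B : set T) :
  measurable A -> measurable B -> P B = 1%E -> P A = P (A `&` B).
Proof.
move=> mA mB PB; rewrite (measureDI P mA mB).
rewrite [X in (X + _)%E](_ : _ = 0%E) ?add0e//.
apply/le_anti; rewrite measure_ge0 andbT.
rewrite -[leRHS](_ : P (~` B) = 0%E); last by rewrite probability_setC// PB subee.
apply: le_measure; rewrite ?inE; [exact: measurableD|exact: measurableC|].
by move=> x [].
Qed.

Lemma ae_imp (P : probability T R) (A B : T -> Prop) :
  {ae P, forall x, A x} -> (forall x, A x -> B x) -> {ae P, forall x, B x}.
Proof. by move=> aA AB; move: aA; apply: filterS. Qed.

Lemma ae_imp2 (P : probability T R) (A B C : T -> Prop) :
  {ae P, forall x, A x} -> {ae P, forall x, B x} ->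
  (forall x, A x -> B x -> C x) -> {ae P, forall x, C x}.
Proof. by move=> aA aB ABC; move: aA aB; apply: filterS2. Qed.

Lemma ae_nonempty (P : probability T R) (A : T -> Prop) :
  {ae P, forall x, A x} -> exists x, A x.
Proof.
move=> [N [mN N0 AN]]; apply: contrapT => nA.
have : N = setT by apply/seteqP; split=> // x _; apply: AN => Ax; apply: nA; exists x.
move=> NT; move: N0; rewrite NT probability_setT => /eqP; rewrite onee_eq0//.
Qed.

End restriction.

Section preimages.
Context {d1 d2 : measure_display}
  {T1 : measurableType d1} {T2 : measurableType d2}.

Lemma measurable_preimage_fst (A : set T1) :
  measurable A -> measurable (fst @^-1` A : set (T1 * T2)).
Proof. by move=> mA; rewrite -[X in measurable X]setTI; exact: measurable_fst. Qed.

Lemma measurable_preimage_snd (A : set T2) :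
  measurable A -> measurable (snd @^-1` A : set (T1 * T2)).
Proof. by move=> mA; rewrite -[X in measurable X]setTI; exact: measurable_snd. Qed.

End preimages.

Section marginals.
Context {R : realType} {d1 d2 : measure_display}
  {T1 : measurableType d1} {T2 : measurableType d2}.
Variables (P1 : probability T1 R) (P2 : probability T2 R)
  (pi : probability (T1 * T2)%type R).
Hypothesis cpl : coupling P1 P2 pi.

Lemma ge0_integral_fst (f : T1 -> \bar R) : measurable_fun setT f ->
  (forall x, (0 <= f x)%E) -> (\int[pi]_z f z.1 = \int[P1]_x f x)%E.
Proof.
move=> mf f0.
rewrite -(preimage_setT fst) -(ge0_integral_pushforward measurable_fst)//.
by apply: (eq_measure_integral P1) => A mA _; exact: cpl.1 A mA.
Qed.

Lemma ge0_integral_snd (f : T2 -> \bar R) : measurable_fun setT f ->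
  (forall x, (0 <= f x)%E) -> (\int[pi]_z f z.2 = \int[P2]_x f x)%E.
Proof.
move=> mf f0.
rewrite -(preimage_setT snd) -(ge0_integral_pushforward measurable_snd)//.
by apply: (eq_measure_integral P2) => A mA _; exact: cpl.2 A mA.
Qed.

Lemma ae_marginal_fst (A : T1 -> Prop) :
  {ae P1, forall x, A x} -> {ae pi, forall z, A z.1}.
Proof.
move=> [N [mN N0 AN]]; exists (fst @^-1` N); split.
- exact: measurable_preimage_fst.
- by rewrite cpl.1.
- by move=> z nA; exact: AN.
Qed.

Lemma ae_marginal_snd (A : T2 -> Prop) :
  {ae P2, forall x, A x} -> {ae pi, forall z, A z.2}.
Proof.
move=> [N [mN N0 AN]]; exists (snd @^-1` N); split.
- exact: measurable_preimage_snd.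
- by rewrite cpl.2.
- by move=> z nA; exact: AN.
Qed.

Lemma ae_fst (A : set T1) : measurable A -> P1 A = 1%E -> {ae pi, forall z, A z.1}.
Proof. by move=> mA PA; apply: ae_marginal_fst; exact: ae_full. Qed.

Lemma ae_snd (A : set T2) : measurable A -> P2 A = 1%E -> {ae pi, forall z, A z.2}.
Proof. by move=> mA PA; apply: ae_marginal_snd; exact: ae_full. Qed.

End marginals.

Section probability_of.
Context d (T : measurableType d) (R : realType).
Variables (m : {measure set T -> \bar R}) (m1 : m setT = 1%E).

(** A named function that depends on the proof of the mass equation, so that
    the structure of a probability can be attached to it. *)
Definition probability_of (_ : m setT = 1%E) : set T -> \bar R := m.

Let p0 : probability_of m1 set0 = 0%E. Proof. exact: measure0. Qed.
Let p_ge0 A : (0 <= probability_of m1 A)%E. Proof. exact: measure_ge0. Qed.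
Let p_additive : semi_sigma_additive (probability_of m1).
Proof. exact: measure_semi_sigma_additive. Qed.

HB.instance Definition _ :=
  isMeasure.Build _ _ _ (probability_of m1) p0 p_ge0 p_additive.
HB.instance Definition _ :=
  Measure_isProbability.Build _ _ _ (probability_of m1) m1.

End probability_of.

Section image.
Context {R : realType} {d1 d2 : measure_display}
  {T1 : measurableType d1} {T2 : measurableType d2}.

Definition image_measure (m : {measure set T1 -> \bar R}) (f : T1 -> T2)
    (mf : measurable_fun setT f) : {measure set T2 -> \bar R} :=
  measure_function_pushforward__canonical__measure_function_Measure m mf.

Lemma ge0_integral_image m f (mf : measurable_fun setT f) (h : T2 -> \bar R) :
  measurable_fun setT h -> (forall y, (0 <= h y)%E) ->
  (\int[image_measure m mf]_y h y = \int[m]_x h (f x))%E.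
Proof.
by move=> mh h0; rewrite /image_measure/= (ge0_integral_pushforward mf)//= preimage_setT.
Qed.

End image.

(** * Optimal plans are cyclically monotone *)

Section perturbation.
Context {R : realType} {d1 d2 : measure_display}
  {T1 : measurableType d1} {T2 : measurableType d2}.
Variables (P1 : probability T1 R) (P2 : probability T2 R)
  (pi : probability (T1 * T2)%type R).
Hypothesis cpl : coupling P1 P2 pi.
Variables (W : nat -> set (T1 * T2)) (n : nat) (m : R).
Hypothesis mW : forall i, measurable (W i).
Hypothesis W_cyclic : W n.+1 = W 0%N.
Hypothesis m_gt0 : 0 < m.

Definition mass i : R := fine (pi (W i)).

Hypothesis m_le : forall i, m <= mass i.

Let piE A : measurable A -> pi A = (fine (pi A))%:E.
Proof. by move=> mA; rewrite fineK// fin_num_measure. Qed.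

Let mass_gt0 i : 0 < mass i := lt_le_trans m_gt0 (m_le i).

Lemma measurable_swap : measurable_fun setT
  (fun p : (T1 * T2) * (T1 * T2) => (p.1.1, p.2.2)).
Proof.
apply: measurable_fun_pair.
  exact: (measurableT_comp measurable_fst measurable_fst).
exact: (measurableT_comp measurable_snd measurable_snd).
Qed.

Let mWW i : measurable (W i `*` W i.+1) := measurableX (mW i) (mW i.+1).

(** First coordinates drawn from [W i], second ones, independently, from
    [W i.+1]; total mass [mass i * mass i.+1]. *)
Definition swapped i := image_measure (mrestr (pi \x pi)%E (mWW i)) measurable_swap.

Let keep_ge0 i : 0 <= 1 - m / mass i.
Proof. by rewrite subr_ge0 ler_pdivrMr// mul1r. Qed.

Let move_ge0 i : 0 <= m / (mass i * mass i.+1).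
Proof. by rewrite divr_ge0 ?mulr_ge0// ltW. Qed.

(** The mass [m] taken from [W i] is replaced by mass from [swapped i]. The
    combination of restrictions of [pi] has nonnegative coefficients, and so
    avoids the subtraction of measures. Its first marginal is that of [pi]; its
    second one differs by a term that telescopes along the cycle. *)
Definition perturbed i : {measure set (T1 * T2) -> \bar R} :=
  measure_add (mrestr pi (measurableC (mW i)))
    (measure_add (mscale (NngNum (keep_ge0 i)) (mrestr pi (mW i)))
                 (mscale (NngNum (move_ge0 i)) (swapped i))).

Let inv_ge0 : 0 <= n.+1%:R^-1 :> R.
Proof. by rewrite invr_ge0. Qed.

(** The plan obtained by moving, along the cycle, the mass [m / n.+1] out of
    each [W i] and sending it to the second coordinates of [W i.+1]. *)
Definition competitor : {measure set (T1 * T2) -> \bar R} :=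
  mscale (NngNum inv_ge0) (msum perturbed n.+1).

Let split_mass A i : measurable A ->
  fine (pi A) = fine (pi (A `&` ~` W i)) + fine (pi (A `&` W i)).
Proof.
move=> mA; rewrite -fineD ?fin_num_measure//; last 2 first.
- by apply: measurableI => //; exact: measurableC.
- exact: measurableI.
rewrite -measureU//; last 3 first.
- by apply: measurableI => //; exact: measurableC.
- exact: measurableI.
- by rewrite setIACA setICl setI0.
by rewrite -setIUr setUCl setIT.
Qed.

Let prodE A B : measurable A -> measurable B ->
  (pi \x pi)%E (A `*` B) = (fine (pi A) * fine (pi B))%:E.
Proof.
move=> mA mB; rewrite product_measure1E// EFinM.
by congr (_ * _)%E; exact: piE.
Qed.

Lemma perturbedE i A : perturbed i A =
  (pi (A `&` ~` W i) + ((1 - m / mass i)%:E * pi (A `&` W i) +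
    (m / (mass i * mass i.+1))%:E *
      (pi \x pi) ((fun p => (p.1.1, p.2.2)) @^-1` A `&` (W i `*` W i.+1))))%E.
Proof.
etransitivity; first exact: measure_addE.
by congr (_ + _)%E; etransitivity; first exact: measure_addE.
Qed.

Lemma perturbed_fst i B : measurable B ->
  perturbed i (fst @^-1` B) = pi (fst @^-1` B).
Proof.
move=> mB; have mA := @measurable_preimage_fst _ _ T1 T2 B mB.
set A := fst @^-1` B in mA *.
have mAW : measurable (A `&` W i) by exact: measurableI.
have mAWc : measurable (A `&` ~` W i) by apply: measurableI => //; exact: measurableC.
rewrite perturbedE.
have -> : (fun p : (T1 * T2) * (T1 * T2) => (p.1.1, p.2.2)) @^-1` A `&` (W i `*` W i.+1) =
    (A `&` W i) `*` W i.+1.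
  by apply/seteqP; split=> [[p q]|[p q]] /= [] => [? []|[]].
rewrite prodE// (piE mA) (piE mAW) (piE mAWc) -/(mass i.+1) -!EFinM -!EFinD (split_mass i mA); congr (_%:E).
by field; rewrite !gt_eqF.
Qed.

Lemma perturbed_snd i B : measurable B ->
  perturbed i (snd @^-1` B) = (fine (pi (snd @^-1` B))
    + m / mass i.+1 * fine (pi (snd @^-1` B `&` W i.+1))
    - m / mass i * fine (pi (snd @^-1` B `&` W i)))%:E.
Proof.
move=> mB; have mA := @measurable_preimage_snd _ _ T1 T2 B mB.
set A := snd @^-1` B in mA *.
have mAW j : measurable (A `&` W j) by exact: measurableI.
have mAWc : measurable (A `&` ~` W i) by apply: measurableI => //; exact: measurableC.
rewrite perturbedE.
have -> : (fun p : (T1 * T2) * (T1 * T2) => (p.1.1, p.2.2)) @^-1` A `&` (W i `*` W i.+1) =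
    W i `*` (A `&` W i.+1).
  by apply/seteqP; split=> [[p q]|[p q]] /= [] => [? []|? []].
rewrite prodE// (piE (mAW i)) (piE mAWc) -/(mass i) -!EFinM -!EFinD (split_mass i mA); congr (_%:E).
by field; rewrite !gt_eqF.
Qed.

Lemma competitor_fst B : measurable B -> competitor (fst @^-1` B) = P1 B.
Proof.
move=> mB; rewrite /competitor/= /mscale/= /msum.
under eq_bigr do rewrite perturbed_fst// cpl.1//.
have -> : P1 B = (fine (P1 B))%:E by rewrite fineK// fin_num_measure.
rewrite sumEFin sumr_const card_ord -EFinM -[X in _ * X]mulr_natl.
by rewrite mulrA mulVf ?mul1r.
Qed.

Lemma competitor_snd B : measurable B -> competitor (snd @^-1` B) = P2 B.
Proof.
move=> mB; rewrite /competitor/= /mscale/= /msum.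
pose h i := m / mass i * fine (pi (snd @^-1` B `&` W i)).
under eq_bigr do rewrite perturbed_snd// cpl.2// -addrA -/(h _) -/(h _).
have -> : P2 B = (fine (P2 B))%:E by rewrite fineK// fin_num_measure.
rewrite sumEFin big_split/= sumr_const card_ord.
rewrite -(big_mkord xpredT (fun i => h i.+1 - h i)) telescope_sumr//.
have -> : h n.+1 = h 0%N by rewrite /h /mass W_cyclic.
rewrite subrr addr0 -EFinM -[X in _ * X]mulr_natl.
by rewrite mulrA mulVf ?mul1r.
Qed.

Lemma competitor_setT : competitor setT = 1%E.
Proof. by rewrite -(preimage_setT fst) competitor_fst// probability_setT. Qed.

Definition competitor_probability : probability (T1 * T2)%type R :=
  probability_of competitor_setT.

Lemma coupling_competitor : coupling P1 P2 competitor_probability.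
Proof. by split=> B mB; [exact: competitor_fst|exact: competitor_snd]. Qed.

(** The mass moved out of [W i] cost at least [a i] per unit, and costs at most
    [b i] in its new place. *)
Lemma competitor_integral (c : T1 * T2 -> R) (a b : nat -> R) :
  measurable_fun setT c -> (forall z, 0 <= c z) ->
  (\int[pi]_z (c z)%:E < +oo)%E ->
  (forall i z, W i z -> a i <= c z) ->
  (forall i z z', W i z -> W i.+1 z' -> c (z.1, z'.2) <= b i) ->
  (\int[competitor]_z (c z)%:E <= \int[pi]_z (c z)%:E +
     (m / n.+1%:R * \sum_(i < n.+1) (b i - a i))%:E)%E.
Proof.
move=> mc c0 cfin ca cb.
have mcE : measurable_fun setT (EFin \o c) by exact/measurable_EFinP.
have c0E z : (0 <= (EFin \o c) z)%E by rewrite lee_fin.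
have Ifin : (\int[pi]_z (c z)%:E)%E \is a fin_num.
  by rewrite ge0_fin_numE//; apply: integral_ge0 => z _; rewrite lee_fin.
set C := fine (\int[pi]_z (c z)%:E).
have CE : (\int[pi]_z (c z)%:E)%E = C%:E by rewrite fineK.
suff each i : (\int[perturbed i]_z (c z)%:E <= (C + m * (b i - a i))%:E)%E.
  rewrite /competitor ge0_integral_mscale//; last by move=> z _; rewrite lee_fin.
  have -> : (\int[msum perturbed n.+1]_z (c z)%:E =
      \sum_(i < n.+1) \int[perturbed i]_z (c z)%:E)%E.
    by apply: ge0_integral_measure_sum => // z _; rewrite lee_fin.
  rewrite CE -EFinD.
  apply: (@le_trans _ _ (n.+1%:R^-1%:E * \sum_(i < n.+1) (C + m * (b i - a i))%:E)%E).
    by apply: lee_wpmul2l; [rewrite lee_fin|apply: lee_sum => i _; exact: each].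
  rewrite sumEFin -EFinM lee_fin big_split/= sumr_const card_ord -mulr_sumr.
  rewrite mulrDr -[X in n.+1%:R^-1 * X + _]mulr_natl mulrA mulVf// mul1r.
  by rewrite mulrA [_^-1 * m]mulrC.
have mWc : measurable (~` W i) by exact: measurableC.
have mcE_swap := measurableT_comp mcE measurable_swap.
pose I1 := (\int[pi]_(z in ~` W i) (c z)%:E)%E.
pose I2 := (\int[pi]_(z in W i) (c z)%:E)%E.
pose I3 := (\int[pi \x pi]_(p in W i `*` W i.+1) (c (p.1.1, p.2.2))%:E)%E.
have -> : (\int[perturbed i]_z (c z)%:E)%E =
    (I1 + ((1 - m / mass i)%:E * I2 + (m / (mass i * mass i.+1))%:E * I3))%E.
  etransitivity; first by apply: ge0_integral_measure_add => // z _; exact: c0E.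
  congr (_ + _)%E; first exact: ge0_integral_mrestr.
  etransitivity; first by apply: ge0_integral_measure_add => // z _; exact: c0E.
  congr (_ + _)%E; etransitivity; try by apply: ge0_integral_mscale => // z _; exact: c0E.
    by congr (_ * _)%E; exact: ge0_integral_mrestr.
  congr (_ * _)%E; etransitivity; first exact: ge0_integral_image.
  by apply: ge0_integral_mrestr => // p; rewrite lee_fin.
have I12 : (I1 + I2)%E = C%:E.
  rewrite -CE addeC -ge0_integral_setU ?setUv//.
    by move=> z _; exact: c0E.
  by rewrite disj_set2E setICr.
have I1_0 : (0 <= I1)%E by apply: integral_ge0 => z _; exact: c0E.
have I2_0 : (0 <= I2)%E by apply: integral_ge0 => z _; exact: c0E.
have I1f : I1 \is a fin_num.
  by rewrite ge0_fin_numE//; apply: le_lt_trans (ltry C); rewrite -I12 leeDl.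
have I2f : I2 \is a fin_num.
  by rewrite ge0_fin_numE//; apply: le_lt_trans (ltry C); rewrite -I12 leeDr.
have I2_ge : a i * mass i <= fine I2.
  have [ai|ai] := leP 0 (a i); last first.
    apply: (@le_trans _ _ 0); last exact: fine_ge0.
    by rewrite mulr_le0_ge0// ltW.
  rewrite -lee_fin fineK// EFinM /mass fineK ?fin_num_measure//.
  rewrite -(integral_cst pi (mW i)); apply: ge0_le_integral => //.
    exact: measurable_funTS.
  by move=> z Wz; rewrite lee_fin; exact: ca.
have I3_le : (\int[pi \x pi]_(p in W i `*` W i.+1) (c (p.1.1, p.2.2))%:E <=
    (b i * (mass i * mass i.+1))%:E)%E.
  apply: (@le_trans _ _ (\int[pi \x pi]_(p in W i `*` W i.+1) (cst (b i)%:E p))%E).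
    apply: ge0_le_integral => //=.
    - by move=> p _; rewrite lee_fin.
    - exact: measurable_funTS.
    - by move=> [p q] [/= Wp Wq]; rewrite lee_fin; exact: cb Wp Wq.
  rewrite integral_cst// EFinM le_eqVlt; apply/orP; left; apply/eqP.
  by congr (_ * _)%E; exact: prodE.
apply: (@le_trans _ _ (I1 + ((1 - m / mass i)%:E * I2 +
    (m / (mass i * mass i.+1))%:E * (b i * (mass i * mass i.+1))%:E)))%E.
  by rewrite leeD2l// leeD2l// lee_wpmul2l// lee_fin.
move: I12 I2_ge; rewrite -(fineK I1f) -(fineK I2f) -!EFinM -!EFinD lee_fin => -[<-] /=.
set u := fine I1; set v := fine I2 => uv.
have -> : m / (mass i * mass i.+1) * (b i * (mass i * mass i.+1)) = m * b i.
  by field; rewrite !gt_eqF.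
have : m * a i <= m / mass i * v.
  rewrite -mulrA ler_pM2l// mulrC ler_pdivlMr//.
lra.
Qed.

(** Sets of positive measure take the place of the points of a cycle: moving a
    little mass along the cycle cannot lower the cost of an optimal plan. *)
Lemma optimal_cyclic_boxes (c : T1 * T2 -> R) (a b : nat -> R) :
  optimal_plan c P1 P2 pi ->
  measurable_fun setT c -> (forall z, 0 <= c z) ->
  (\int[pi]_z (c z)%:E < +oo)%E ->
  (forall i z, W i z -> a i <= c z) ->
  (forall i z z', W i z -> W i.+1 z' -> c (z.1, z'.2) <= b i) ->
  \sum_(i < n.+1) a i <= \sum_(i < n.+1) b i.
Proof.
move=> [_ opt] mc c0 cfin ca cb.
have := le_trans (opt _ coupling_competitor) (competitor_integral mc c0 cfin ca cb).
have Ifin : (\int[pi]_z (c z)%:E)%E \is a fin_num.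
  by rewrite ge0_fin_numE//; apply: integral_ge0 => z _; rewrite lee_fin.
rewrite -(fineK Ifin) -EFinD lee_fin lerDl pmulr_rge0 ?divr_gt0//.
by rewrite sumrB subr_ge0.
Qed.

End perturbation.

(** * Kantorovich potentials *)

Section chains.
Context {R : realType} {d : nat}.
Local Notation V := 'rV[R]_d.
Implicit Types (z w : V * V) (s : seq (V * V)) (y : V).

(** The affine function of [y] obtained by following subgradients along the
    points [z :: s] of a graph. *)
Fixpoint chain z s y : R :=
  if s is w :: s' then dot z.1 (w.2 - z.2) + chain w s' y else dot z.1 (y - z.2).

Lemma chain_slope z s y y' :
  chain z s y - chain z s y' = dot (last z s).1 (y - y').
Proof.
elim: s z => [|w s IH] z /=; first by rewrite -dotBr opprB subrKA.
by rewrite opprD addrACA subrr add0r IH.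
Qed.

Lemma chain_rcons z s w y :
  chain z (rcons s w) y = chain z s w.2 + dot w.1 (y - w.2).
Proof. by elim: s z => [|u s IH] z //=; rewrite IH addrA. Qed.

Lemma chain_sum z z0 s :
  chain z s z0.2 = \sum_(i < (size s).+1)
    (dot (nth z0 (z :: s) i).1 (nth z0 (z :: s) i.+1).2
     - dot (nth z0 (z :: s) i).1 (nth z0 (z :: s) i).2).
Proof.
elim: s z => [|w s IH] z; first by rewrite big_ord1 /= dotBr.
by rewrite big_ord_recl /= dotBr IH.
Qed.

Variables (S : set (V * V)) (X Y : set V).
Hypothesis S_sub : forall z, S z -> X z.1 /\ Y z.2.
Hypothesis compact_X : compact X.
Hypothesis S_monotone : forall z0 s, S z0 -> (forall w, w \in s -> S w) ->
  chain z0 s z0.2 <= 0.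

(** Rockafellar's construction, on the side of the second variable: [psi] is the
    supremum of the chains that start at [z0]. Cyclic monotonicity makes it
    finite, all chains are affine with slopes in [X], and lengthening a chain by
    [z] gives the subgradient inequality at [z]. *)
Lemma rockafellar z0 : S z0 -> exists psi : V -> R,
  slopes_in X psi /\
  forall z y, S z -> psi z.2 + dot z.1 (y - z.2) <= psi y.
Proof.
move=> Sz0; pose A y := [set chain z0 s y | s in [set s : seq (V * V) | forall w, w \in s -> S w]].
have lastX s : (forall w, w \in s -> S w) -> X (last z0 s).1.
  move=> sS; have := mem_last z0 s; rewrite inE => /predU1P[->|/sS /S_sub[]//].
  by have [] := S_sub Sz0.
have [B _ XB] := compact_enorm_bounded compact_X.
have A0 y : A y !=set0 by exists (chain z0 [::] y), [::].
have ubA y : has_ubound (A y).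
  exists (B * enorm (y - z0.2)) => _ [s sS <-].
  have := chain_slope z0 s y z0.2; have := S_monotone Sz0 sS.
  have : dot (last z0 s).1 (y - z0.2) <= B * enorm (y - z0.2).
    apply: (le_trans (dot_le_enorm _ _)); apply: ler_wpM2r; first exact: enorm_ge0.
    by apply: XB; exact: lastX.
  lra.
have leA s y : (forall w, w \in s -> S w) -> chain z0 s y <= sup (A y).
  by move=> sS; apply: ub_le_sup => //; exists s.
exists (fun y => sup (A y)); split=> [u v c uv|z y Sz].
  suff : sup (A u) <= sup (A v) + c by lra.
  apply: ge_sup => // _ [s sS <-]; have := chain_slope z0 s u v.
  have := uv _ (lastX s sS); have := leA s v sS; lra.
suff : sup (A z.2) <= sup (A y) - dot z.1 (y - z.2) by lra.
apply: ge_sup => // _ [s sS <-]; rewrite lerBrDr -chain_rcons; apply: leA => w.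
by rewrite mem_rcons inE => /predU1P[->//|/sS].
Qed.

(** [phi] is the Legendre transform of [psi] restricted to [Y], a maximum by
    compactness. *)
Lemma conjugate_exists z0 : compact Y -> S z0 ->
  exists phi psi : V -> R, [/\ conjugate Y phi psi, slopes_in X psi &
    forall z, S z -> subgrad Y phi psi z.1 z.2].
Proof.
move=> cY Sz0; have [psi [sl sub]] := rockafellar Sz0.
have [_ Yz0] := S_sub Sz0.
have [B _ XB] := compact_enorm_bounded compact_X.
have cpsi : continuous psi.
  exact: lipschitz_enorm_continuous (slopes_in_lipschitz XB sl).
have cdot (x : V) : continuous (dot x : V -> R).
  apply: (@lipschitz_enorm_continuous _ _ (enorm x)) => u v.
  rewrite -dotBr ler_norml dot_le_enorm andbT lerNl -dotNl -(enormN x).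
  exact: dot_le_enorm.
have h (x : V) : {y | Y y /\ forall y', Y y' -> dot x y' - psi y' <= dot x y - psi y}.
  apply: cid; have [||y /set_mem Yy yP] := @EVT_max_rV R d (fun y => dot x y - psi y) Y _ cY.
  - by exists z0.2.
  - apply: continuous_subspaceT => y; apply: continuousB; [exact: cdot|exact: cpsi].
  - by exists y; split=> // y' Yy'; apply: yP; exact/mem_set.
pose phi (x : V) := dot x (projT1 (h x)) - psi (projT1 (h x)).
exists phi, psi; split=> //.
  split=> [x y Yy|x]; rewrite /phi; case: (h x) => y' [Yy' le] /=.
    by have := le y Yy; lra.
  by exists y' => //; lra.
move=> z Sz; have [_ Yz] := S_sub Sz; split=> //; rewrite /phi.
case: (h z.1) => y' [Yy' le] /=; have := le _ Yz; have := sub z y' Sz.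
by rewrite dotBr; lra.
Qed.

End chains.

Section optimal_potentials.
Context {R : realType} {d : nat}.
Local Notation V := 'rV[R]_d.
Local Notation E := (borel_rV R d).
Variables (X Y : set V).
Hypotheses (compact_X : compact X) (compact_Y : compact Y).

(** A partition into cells of size [k.+1%:R^-1] is finite, so that its cells of
    measure zero form a null set; [S] is what remains when these are removed for
    all [k]. *)
Lemma support_exists (pi : probability (E * E)%type R) :
  {ae pi, forall z, X z.1 /\ Y z.2} ->
  exists2 S : set (V * V), {ae pi, forall z, S z} & forall z, S z ->
    (X z.1 /\ Y z.2) /\ forall e, 0 < e -> exists W : set (E * E),
      [/\ measurable W, W z, (0 < pi W)%E & forall w, W w ->
        [/\ X w.1, Y w.2, enorm (w.1 - z.1 : V) <= e & enorm (w.2 - z.2 : V) <= e]].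
Proof.
move=> aeXY.
have step0 k : 0 < k.+1%:R^-1 :> R by rewrite invr_gt0.
pose I k := projT1 (fine_partition compact_X (step0 k)).
pose J k := projT1 (fine_partition compact_Y (step0 k)).
pose f k : V -> I k := projT1 (projT2 (fine_partition compact_X (step0 k))).
pose g k : V -> J k := projT1 (projT2 (fine_partition compact_Y (step0 k))).
have fP k := projT2 (projT2 (fine_partition compact_X (step0 k))).
have gP k := projT2 (projT2 (fine_partition compact_Y (step0 k))).
pose box k (ij : I k * J k) : set (E * E) :=
  (X `&` f k @^-1` [set ij.1]) `*` (Y `&` g k @^-1` [set ij.2]).
have mbox k ij : measurable (box k ij).
  apply: measurableX; apply: measurableI; try exact: compact_measurable_borel.
    exact: (fP k).1.
  exact: (gP k).1.
exists [set z | (X z.1 /\ Y z.2) /\ forall k, (0 < pi (box k (f k z.1, g k z.2)))%E].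
  have aebox : {ae pi, forall z, forall k (ij : I k * J k), box k ij z -> (0 < pi (box k ij))%E}.
    apply/ae_foralln => k; apply: filter_forall => ij.
    have [null|pos] := eqVneq (pi (box k ij)) 0%E; last first.
      by apply: aeW => z _; rewrite lt0e pos measure_ge0.
    exists (box k ij); split => // z /= nz; apply: contrapT => nb.
    by apply: nz => zb; case: nb.
  by apply: (ae_imp2 aeXY aebox) => z [Xz Yz] h; split=> // k; apply: h.
move=> z [[Xz Yz] pos]; split=> // e e0.
pose k := Num.trunc e^-1.
have ke : k.+1%:R^-1 <= e.
  rewrite -[e]invrK lef_pV2 ?posrE ?invr_gt0// ltW//.
  by have /andP[] := truncn_itv (ltW (etrans (invr_gt0 e) e0)).
exists (box k (f k z.1, g k z.2)); split=> // w [/= [Xw fw] [Yw gw]].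
split=> //; apply: le_trans ke.
  exact: (fP k).2.
exact: (gP k).2.
Qed.

Local Notation cost := (fun z : E * E => enorm (z.1 - z.2 : V) ^+ 2).

Lemma measurable_cost : measurable_fun setT cost.
Proof.
apply: measurable_funX; apply: measurable_enorm_sub; [exact: measurable_fst|].
exact: measurable_snd.
Qed.

Lemma cost_integral_lty (pi : probability (E * E)%type R) :
  {ae pi, forall z, X z.1 /\ Y z.2} -> (\int[pi]_z (cost z)%:E < +oo)%E.
Proof.
move=> aeXY; have [B1 B10 XB] := compact_enorm_bounded compact_X.
have [B2 B20 YB] := compact_enorm_bounded compact_Y.
apply: (@le_lt_trans _ _ (\int[pi]_z (cst ((B1 + B2) ^+ 2)%:E z))%E); last first.
  by rewrite integral_cst//= probability_setT mule1 ltry.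
apply: ae_ge0_le_integral => //.
- by move=> z _; rewrite lee_fin sqr_ge0.
- by apply/measurable_EFinP; exact: measurable_cost.
- by move=> z _; rewrite lee_fin sqr_ge0.
apply: (ae_imp aeXY) => z [Xz Yz] _; rewrite lee_fin.
rewrite lerXn2r ?nnegrE ?enorm_ge0 ?addr_ge0 ?(ltW B10) ?(ltW B20)//.
by rewrite (le_trans (enormD _ _))// enormN lerD// ?XB// YB.
Qed.

Lemma lower_bound_on_seq (T : eqType) (g : T -> R) (s : seq T) :
  (forall z, z \in s -> 0 < g z) ->
  exists2 m, 0 < m & forall z, z \in s -> m <= g z.
Proof.
elim: s => [|a s IH] pos; first by exists 1.
have [|m m0 mP] := IH; first by move=> z zs; apply: pos; rewrite inE zs orbT.
exists (Num.min m (g a)) => [|z].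
  by rewrite lt_min m0 pos// inE eqxx.
by rewrite inE ge_min => /predU1P[->|/mP ->//]; rewrite lexx orbT.
Qed.

(** Shrinking the neighbourhoods in [optimal_cyclic_boxes] gives the cyclic
    inequality for the cost at points of the support. For the quadratic cost
    it is the one for the inner product, as the squared norms of the second
    coordinates cancel along the cycle. *)
Lemma optimal_cyclically_monotone (rho mu : probability E R)
    (pi : probability (E * E)%type R) (S : set (V * V)) :
  Gamma rho mu pi ->
  {ae pi, forall z, X z.1 /\ Y z.2} ->
  (forall z, S z ->
    (X z.1 /\ Y z.2) /\ forall e, 0 < e -> exists W : set (E * E),
      [/\ measurable W, W z, (0 < pi W)%E & forall w, W w ->
        [/\ X w.1, Y w.2, enorm (w.1 - z.1 : V) <= e & enorm (w.2 - z.2 : V) <= e]]) ->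
  forall z0 s, S z0 -> (forall w, w \in s -> S w) -> chain z0 s z0.2 <= 0.
Proof.
move=> opt aeXY SP z0 s Sz0 sS; pose p i := nth z0 (z0 :: s) i; pose n := size s.
have inS w : w \in z0 :: s -> S w by rewrite inE => /predU1P[->|/sS].
have pS i : p i \in z0 :: s.
  rewrite /p; have [h|h] := ltnP i (size (z0 :: s)); first exact: mem_nth.
  by rewrite nth_default// inE eqxx.
have p_cyc : p n.+1 = p 0%N by rewrite /p nth_default.
have [B1 B10 XB] := compact_enorm_bounded compact_X.
have [B2 B20 YB] := compact_enorm_bounded compact_Y.
pose D := B1 + B2; have D0 : 0 < D by rewrite addr_gt0.
have dD x y : X x -> Y y -> enorm (x - y) <= D.
  by move=> /XB xB /YB yB; rewrite (le_trans (enormD _ _))// enormN lerD.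
have close x y x' y' e : X x -> Y y -> X x' -> Y y' ->
    enorm (x - x') <= e -> enorm (y - y') <= e ->
    enorm (x - y) ^+ 2 <= enorm (x' - y') ^+ 2 + 4 * D * e.
  move=> Xx Yy Xx' Yy' xe ye; have := le_dist_dist x y x' y'.
  have := dD _ _ Xx Yy; have := dD _ _ Xx' Yy'.
  have := enorm_ge0 (x - y); have := enorm_ge0 (x' - y').
  have := enorm_ge0 (x - x'); nra.
have sums : \sum_(i < n.+1) cost (p i) <= \sum_(i < n.+1) cost ((p i).1, (p i.+1).2).
  apply/ler_addgt0Pr => eta eta0.
  (* Within a neighbourhood of size [e] the cost varies by at most [4 * D * e];
     this is paid twice at each of the [n.+1] points. *)
  pose e := eta / (8 * D * n.+1%:R).
  have e0 : 0 < e by rewrite divr_gt0// !mulr_gt0.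
  have near z : {W : set (E * E) | S z -> [/\ measurable W, W z, (0 < pi W)%E &
      forall w, W w -> [/\ X w.1, Y w.2, enorm (w.1 - z.1 : V) <= e
        & enorm (w.2 - z.2 : V) <= e]]}.
    apply: cid; have [Sz|nSz] := pselect (S z); last by exists set0.
    by have [_ /(_ e e0)[W WP]] := SP z Sz; exists W.
  pose Wf z := projT1 (near z); have WP z : S z -> _ := projT2 (near z).
  have [m m0 mP] : exists2 m, 0 < m & forall z, z \in z0 :: s -> m <= fine (pi (Wf z)).
    apply: lower_bound_on_seq => z /inS Sz; have [mW _ Wpos _] := WP z Sz.
    by rewrite fine_gt0// Wpos -ge0_fin_numE// fin_num_measure.
  have SpP i := WP (p i) (inS _ (pS i)).
  have mW i : measurable (Wf (p i)) by have [] := SpP i.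
  have Wcyc : Wf (p n.+1) = Wf (p 0%N) by rewrite p_cyc.
  have := @optimal_cyclic_boxes R _ _ E E rho mu pi opt.1 (fun i => Wf (p i)) n m mW
    Wcyc m0 (fun i => mP _ (pS i)) cost
    (fun i => cost (p i) - 4 * D * e)
    (fun i => cost ((p i).1, (p i.+1).2) + 4 * D * e) opt measurable_cost
    (fun z => sqr_ge0 _) (cost_integral_lty aeXY).
  rewrite sumrB big_split/= sumr_const card_ord -[X in _ - X]mulr_natl.
  rewrite -[X in _ <= _ + X]mulr_natl.
  have -> : n.+1%:R * (4 * D * e) = eta / 2.
    by rewrite /e; field; rewrite ?gt_eqF.
  move=> h; suff : \sum_(i < n.+1) cost (p i) - eta / 2 <=
    \sum_(i < n.+1) cost ((p i).1, (p i.+1).2) + eta / 2 by lra.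
  apply: h => [i w Ww|i w w' Ww Ww'].
    have [_ _ _ /(_ w Ww)[Xw Yw d1 d2]] := SpP i.
    have [[Xp Yp] _] := SP _ (inS _ (pS i)).
    rewrite enormB in d1; rewrite enormB in d2.
    have := close _ _ _ _ _ Xp Yp Xw Yw d1 d2; lra.
  have [_ _ _ /(_ w Ww)[Xw Yw d1 d2]] := SpP i.
  have [_ _ _ /(_ w' Ww')[Xw' Yw' d1' d2']] := SpP i.+1.
  have [[Xp Yp] _] := SP _ (inS _ (pS i)).
  have [[Xp' Yp'] _] := SP _ (inS _ (pS i.+1)).
  exact: (close _ _ _ _ _ Xw Yw' Xp Yp' d1 d2').
pose y2 i := dot (p i).2 (p i).2.
have tel : \sum_(i < n.+1) (y2 i.+1 - y2 i) = 0.
  by rewrite -(big_mkord xpredT (fun i => y2 i.+1 - y2 i)) telescope_sumr// /y2 p_cyc subrr.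
suff : 2 * chain z0 s z0.2 <= 0 by lra.
rewrite chain_sum mulr_sumr.
have -> : \sum_(i < n.+1) 2 * (dot (nth z0 (z0 :: s) i).1 (nth z0 (z0 :: s) i.+1).2
     - dot (nth z0 (z0 :: s) i).1 (nth z0 (z0 :: s) i).2) =
   \sum_(i < n.+1) cost (p i) - \sum_(i < n.+1) cost ((p i).1, (p i.+1).2)
   + \sum_(i < n.+1) (y2 i.+1 - y2 i).
  rewrite -sumrB -big_split; apply: eq_bigr => i _ /=.
  rewrite !enorm_sqr !dotBl !dotBr -/(p i) -/(p i.+1) /y2.
  rewrite (dotC (p i).2 (p i).1) (dotC (p i.+1).2 (p i).1); ring.
by rewrite tel addr0 subr_le0.
Qed.

(** The potentials come from Rockafellar's theorem on the support of the plan,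
    which is of full measure and cyclically monotone. *)
Theorem optimal_potentials (rho mu : probability E R)
    (pi : probability (E * E)%type R) :
  Gamma rho mu pi -> rho X = 1%E -> mu Y = 1%E ->
  exists phi psi : V -> R, [/\ conjugate Y phi psi, slopes_in X psi &
    {ae pi, forall z, (X z.1 /\ Y z.2) /\ subgrad Y phi psi z.1 z.2}].
Proof.
move=> opt rX mY.
have aeXY : {ae pi, forall z, X z.1 /\ Y z.2}.
  apply: (ae_imp2 (ae_fst opt.1 (compact_measurable_borel compact_X) rX)
    (ae_snd opt.1 (compact_measurable_borel compact_Y) mY)) => z; exact: conj.
have [S aeS SP] := support_exists aeXY.
have [z0 Sz0] := ae_nonempty aeS.
have [phi [psi [cj sl sub]]] := conjugate_exists (fun z Sz => (SP z Sz).1)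
  compact_X (optimal_cyclically_monotone opt aeXY SP) compact_Y Sz0.
exists phi, psi; split=> //; apply: (ae_imp aeS) => z Sz.
by split; [exact: (SP z Sz).1|exact: sub].
Qed.

End optimal_potentials.

(** * Gluing along a finite partition *)

Section finite_maps.
Context d (T : measurableType d) (R : realType).
Variables (P : probability T R) (I : finType) (kappa : T -> I).
Hypothesis mkappa : forall i, measurable (kappa @^-1` [set i]).

Lemma sum_fibers A : measurable A ->
  P A = (\sum_i P (A `&` kappa @^-1` [set i]))%E.
Proof.
move=> mA; pose F (k : 'I_#|I|) := A `&` kappa @^-1` [set enum_val k].
transitivity (P (\big[setU/set0]_(k < #|I|) F k)).
  congr (P _); rewrite -(bigcup_pred (@predT 'I_#|I|)); apply/seteqP.
  split=> [x Ax|x [k _ []//]].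
  by exists (enum_rank (kappa x)) => //; split; rewrite //= enum_rankK.
rewrite measure_bigsetU_ord//.
- by rewrite [RHS](reindex _ (onW_bij _ (enum_val_bij I))).
- by move=> k; exact: measurableI.
apply/trivIsetP => i j _ _ ij; apply/seteqP; split=> x //= -[[_ xi] [_ xj]].
by move/eqP: ij; apply; apply: enum_val_inj; rewrite -xi -xj.
Qed.

Lemma integral_finite_map (h : I -> R) : (forall i, 0 <= h i) ->
  (\int[P]_x (h (kappa x))%:E = \sum_i (h i)%:E * P (kappa @^-1` [set i]))%E.
Proof.
move=> h0; pose f i x := (h i * \1_(kappa @^-1` [set i]) x)%:E.
transitivity (\int[P]_x \sum_i f i x)%E.
  apply: eq_integral => x _; rewrite (bigD1 (kappa x))//= big1 ?adde0.
    by rewrite /f indicE mem_set// mulr1.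
  by move=> i ik; rewrite /f indicE memNset ?mulr0//= => /esym/eqP; apply/negP.
rewrite ge0_integral_sum//.
- apply: eq_bigr => i _; rewrite /f; under eq_integral do rewrite EFinM.
  rewrite ge0_integralZl//.
  + by rewrite integral_indic// setIT.
  + by apply/measurable_EFinP; exact: measurable_indic.
  + by rewrite lee_fin.
- move=> i; apply/measurable_EFinP; apply: measurable_funM; first exact: measurable_cst.
  exact: measurable_indic.
- by move=> i x _; rewrite lee_fin mulr_ge0.
Qed.

Lemma measurable_finite_map (h : I -> R) : measurable_fun setT (h \o kappa).
Proof.
have -> : h \o kappa = (fun x => \sum_i h i * \1_(kappa @^-1` [set i]) x).
  apply/funext => x /=; rewrite (bigD1 (kappa x))//= big1 ?addr0.
    by rewrite indicE mem_set// mulr1.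
  by move=> i ik; rewrite indicE memNset ?mulr0//= => /esym/eqP; apply/negP.
apply: measurable_sum => i; apply: measurable_funM; first exact: measurable_cst.
exact: measurable_indic.
Qed.

End finite_maps.

Section gluing.
Context {R : realType} {d0 d1 : measure_display}
  {T0 : measurableType d0} {T1 : measurableType d1}.
Variables (P0 : probability T0 R) (P1 : probability T1 R) (I J : finType).
Variables (k0 : T0 -> I) (k1 : T1 -> J) (a : I -> J -> R).
Hypothesis mk0 : forall i, measurable (k0 @^-1` [set i]).
Hypothesis mk1 : forall j, measurable (k1 @^-1` [set j]).
Hypothesis a_ge0 : forall i j, 0 <= a i j.

Local Notation p i := (fine (P0 (k0 @^-1` [set i]))).
Local Notation q j := (fine (P1 (k1 @^-1` [set j]))).
Hypothesis a_fst : forall i, \sum_j a i j = p i.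
Hypothesis a_snd : forall j, \sum_i a i j = q j.

Let ij0 : I * J := (k0 point, k1 point).
Let ij k := nth ij0 (enum {: I * J}) k.
Let block (u : I * J) : set (T0 * T1) := (k0 @^-1` [set u.1]) `*` (k1 @^-1` [set u.2]).
Let mblock u : measurable (block u) := measurableX (mk0 u.1) (mk1 u.2).
Let w_ge0 u : 0 <= a u.1 u.2 / (p u.1 * q u.2).
Proof. by rewrite divr_ge0 ?mulr_ge0 ?fine_ge0. Qed.

(** Inside each block the two variables are taken independent. *)
Definition glued_measure : {measure set (T0 * T1) -> \bar R} :=
  msum (fun k => mscale (NngNum (w_ge0 (ij k))) (mrestr (P0 \x P1)%E (mblock (ij k))))
    #|{: I * J}|.

Let P0E A : measurable A -> P0 A = (fine (P0 A))%:E.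
Proof. by move=> mA; rewrite fineK// fin_num_measure. Qed.
Let P1E A : measurable A -> P1 A = (fine (P1 A))%:E.
Proof. by move=> mA; rewrite fineK// fin_num_measure. Qed.

Let glued_rect A B : measurable A -> measurable B -> glued_measure (A `*` B) =
  (\sum_i \sum_j a i j / (p i * q j) *
    (fine (P0 (A `&` k0 @^-1` [set i])) * fine (P1 (B `&` k1 @^-1` [set j]))))%:E.
Proof.
move=> mA mB; rewrite pair_big/= -big_enum/= (big_nth ij0) big_mkord -cardE -sumEFin.
apply: eq_bigr => k _; rewrite -/(ij k) [RHS]EFinM; congr (_ * _)%E.
transitivity ((P0 \x P1)%E ((A `&` k0 @^-1` [set (ij k).1]) `*`
    (B `&` k1 @^-1` [set (ij k).2]))).
  by rewrite setXI.
rewrite product_measure1E; try exact: measurableI.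
by rewrite EFinM; congr (_ * _)%E; [exact/P0E/measurableI|exact/P1E/measurableI].
Qed.

Let a0_fst i j : p i = 0 -> a i j = 0.
Proof.
move=> pi0; have := a_fst i; rewrite pi0 => /eqP; rewrite psumr_eq0//.
by move=> /allP/(_ j (mem_index_enum j))/eqP.
Qed.

Let a0_snd i j : q j = 0 -> a i j = 0.
Proof.
move=> qj0; have := a_snd j; rewrite qj0 => /eqP; rewrite psumr_eq0//.
by move=> /allP/(_ i (mem_index_enum i))/eqP.
Qed.

Let glued_fst A : measurable A -> glued_measure (fst @^-1` A) = P0 A.
Proof.
move=> mA; rewrite -setXT glued_rect// (sum_fibers P0 mk0 mA).
rewrite [RHS](eq_bigr (fun i => (fine (P0 (A `&` k0 @^-1` [set i])))%:E)); last first.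
  by move=> i _; apply: P0E; exact: measurableI.
rewrite sumEFin; congr (_%:E); apply: eq_bigr => i _.
set r := fine (P0 (A `&` _)).
have [pi0|pi0] := eqVneq (p i) 0.
  rewrite big1 => [|j _]; last by rewrite a0_fst// !mul0r.
  apply/esym/le_anti/andP; split; last by rewrite fine_ge0.
  by rewrite -pi0 fine_le ?fin_num_measure ?le_measure ?inE//; exact: measurableI.
transitivity (\sum_j a i j / p i * r); last by rewrite -!mulr_suml a_fst divff// mul1r.
apply: eq_bigr => j _; rewrite setTI.
have [qj0|qj0] := eqVneq (q j) 0; first by rewrite a0_snd// !mul0r.
by field; rewrite pi0 qj0.
Qed.

Let glued_snd B : measurable B -> glued_measure (snd @^-1` B) = P1 B.
Proof.
move=> mB; rewrite -setTX glued_rect// (sum_fibers P1 mk1 mB) exchange_big/=.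
rewrite [RHS](eq_bigr (fun j => (fine (P1 (B `&` k1 @^-1` [set j])))%:E)); last first.
  by move=> j _; apply: P1E; exact: measurableI.
rewrite sumEFin; congr (_%:E); apply: eq_bigr => j _.
set r := fine (P1 (B `&` _)).
have [qj0|qj0] := eqVneq (q j) 0.
  rewrite big1 => [|i _]; last by rewrite a0_snd// !mul0r.
  apply/esym/le_anti/andP; split; last by rewrite fine_ge0.
  by rewrite -qj0 fine_le ?fin_num_measure ?le_measure ?inE//; exact: measurableI.
transitivity (\sum_i a i j / q j * r); last by rewrite -!mulr_suml a_snd divff// mul1r.
apply: eq_bigr => i _; rewrite setTI.
have [pi0|pi0] := eqVneq (p i) 0; first by rewrite a0_fst// !mul0r.
by field; rewrite pi0 qj0.
Qed.

Let glued_setT : glued_measure setT = 1%E.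
Proof. by rewrite -(preimage_setT fst) glued_fst// probability_setT. Qed.

Let glued_block i j :
  glued_measure ((k0 @^-1` [set i]) `*` (k1 @^-1` [set j])) = (a i j)%:E.
Proof.
rewrite glued_rect//; congr (_%:E).
rewrite (bigD1 i)//= [X in _ + X]big1 ?addr0; last first.
  move=> i' ii'; rewrite big1// => j' _.
  have -> : k0 @^-1` [set i] `&` k0 @^-1` [set i'] = set0.
    by apply/seteqP; split=> x //= [-> ii]; move: ii'; rewrite ii eqxx.
  by rewrite measure0 mul0r mulr0.
rewrite (bigD1 j)//= big1 ?addr0; last first.
  move=> j' jj'; have -> : k1 @^-1` [set j] `&` k1 @^-1` [set j'] = set0.
    by apply/seteqP; split=> x //= [-> jj]; move: jj'; rewrite jj eqxx.
  by rewrite measure0 !mulr0.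
rewrite !setIid.
have [pi0|pi0] := eqVneq (p i) 0; first by rewrite a0_fst// !mul0r.
have [qj0|qj0] := eqVneq (q j) 0; first by rewrite a0_snd// !mul0r.
by field; rewrite pi0 qj0.
Qed.

(** Couplings of the images of [P0] and [P1] under finite-valued maps lift to
    couplings of [P0] and [P1]. *)
Lemma gluing : exists2 pi : probability (T0 * T1)%type R, coupling P0 P1 pi &
  forall i j, pi ((k0 @^-1` [set i]) `*` (k1 @^-1` [set j])) = (a i j)%:E.
Proof.
exists (probability_of glued_setT); last exact: glued_block.
by split=> A mA; [exact: glued_fst|exact: glued_snd].
Qed.

End gluing.

(** * Coupling two plans through their first marginals *)

Section transport_of_plans.
Context {R : realType} {d : nat}.
Local Notation V := 'rV[R]_d.
Local Notation E := (borel_rV R d).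
Implicit Types rho mu : probability E R.
Local Notation dist := (fun z : E * E => enorm (z.1 - z.2 : V)).

Lemma measurable_dist : measurable_fun setT dist.
Proof. by apply: measurable_enorm_sub; [exact: measurable_fst|exact: measurable_snd]. Qed.

Lemma ae_ge0_le_integralT d' (T : measurableType d') (P : probability T R) (f g : T -> R) :
  measurable_fun setT f -> measurable_fun setT g ->
  (forall x, 0 <= f x) -> (forall x, 0 <= g x) ->
  {ae P, forall x, f x <= g x} -> (\int[P]_x (f x)%:E <= \int[P]_x (g x)%:E)%E.
Proof.
move=> mf mg f0 g0 fg; apply: ae_ge0_le_integral => //.
- by move=> x _; rewrite lee_fin.
- by apply/measurable_EFinP.
- by move=> x _; rewrite lee_fin.
- by apply/measurable_EFinP.
by apply: (ae_imp fg) => x ? _; rewrite lee_fin.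
Qed.

Lemma ge0_integral_addcst d' (T : measurableType d') (P : probability T R) (f : T -> R) c :
  measurable_fun setT f -> (forall x, 0 <= f x) -> 0 <= c ->
  (\int[P]_x (f x + c)%:E = \int[P]_x (f x)%:E + c%:E)%E.
Proof.
move=> mf f0 c0; under eq_integral do rewrite EFinD.
rewrite ge0_integralD//.
- by rewrite (integral_cst P measurableT c%:E)/= probability_setT mule1.
- by move=> x _; rewrite lee_fin.
- by apply/measurable_EFinP.
Qed.

(** An exact gluing of [gamma0], [a] and [gamma1] would disintegrate them with
    respect to the first coordinate. It is enough that [pi] charges each pair of
    cells of a fine partition as much as [a] does: the distances between the
    points of two cells differ little from the distance [h] between
    representatives of these cells, and [h] has the same integral for both
    plans. *)
Lemma coupling_of_plans (X : set V) rho0 rho1 mu0 mu1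
    (gamma0 gamma1 a : probability (E * E)%type R) (e : R) :
  compact X -> rho0 X = 1%E -> rho1 X = 1%E -> 0 < e ->
  coupling rho0 mu0 gamma0 -> coupling rho1 mu1 gamma1 -> coupling rho0 rho1 a ->
  exists2 pi : probability ((E * E) * (E * E))%type R, coupling gamma0 gamma1 pi &
    (\int[pi]_z (enorm (z.1.1 - z.2.1 : V))%:E <= \int[a]_z (dist z)%:E + e%:E)%E.
Proof.
move=> cX r0 r1 e0 c0 c1 ca.
have t0 : 0 < e / 4 by rewrite divr_gt0.
have [I [kappa [mk kP]]] := fine_partition cX t0.
have mk0 i : measurable ((kappa \o fst) @^-1` [set i] : set (E * E)) :=
  measurable_preimage_fst (mk i).
pose A i : set E := kappa @^-1` [set i].
pose w i j := fine (a (A i `*` A j)).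
have aE i j : a (A i `*` A j) = (w i j)%:E.
  by rewrite fineK//; apply: fin_num_measure; apply: measurableX; exact: mk.
have w0 i j : 0 <= w i j by rewrite fine_ge0.
have w_fst i : \sum_j w i j = fine (gamma0 ((kappa \o fst) @^-1` [set i])).
  rewrite [X in fine X](c0.1 (A i) (mk i)) -(ca.1 (A i) (mk i)).
  have mk2 j : measurable ((kappa \o snd) @^-1` [set j] : set (E * E)) :=
    measurable_preimage_snd (mk j).
  have mA : measurable (fst @^-1` A i : set (E * E)) := mk0 i.
  rewrite (sum_fibers a mk2 mA) (eq_bigr (fun j => (w i j)%:E)) ?sumEFin//.
  by move=> j _; rewrite -aE.
have w_snd j : \sum_i w i j = fine (gamma1 ((kappa \o fst) @^-1` [set j])).
  rewrite [X in fine X](c1.1 (A j) (mk j)) -(ca.2 (A j) (mk j)).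
  have mA : measurable (snd @^-1` A j : set (E * E)) :=
    measurable_preimage_snd (mk j).
  rewrite (sum_fibers a mk0 mA) (eq_bigr (fun i => (w i j)%:E)) ?sumEFin//.
  by move=> i _; rewrite -aE setIC.
have [pi cpi piE] := gluing mk0 mk0 w0 w_fst w_snd.
exists pi => //.
(* [r] picks a representative in each cell that meets [X]. *)
have [r rP] : {r : I -> V | forall x, X x -> X (r (kappa x)) /\ kappa (r (kappa x)) = kappa x}.
  have h i : {y : V | forall x, X x -> kappa x = i -> X y /\ kappa y = i}.
    apply: cid; have [[x [Xx xi]]|no] := pselect (exists x, X x /\ kappa x = i).
      by exists x.
    by exists 0 => x Xx xi; case: no; exists x.
  by exists (fun i => projT1 (h i)) => x Xx; exact: (projT2 (h (kappa x)) x).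
pose h (u : I * I) := enorm (r u.1 - r u.2).
have h0 u : 0 <= h u by exact: enorm_ge0.
have close x x' : X x -> X x' -> enorm (x - x') <= h (kappa x, kappa x') + e / 2 /\
    h (kappa x, kappa x') <= enorm (x - x') + e / 2.
  move=> Xx Xx'; have [Xr rx] := rP _ Xx; have [Xr' rx'] := rP _ Xx'.
  have := kP _ _ Xx Xr (esym rx); have := kP _ _ Xx' Xr' (esym rx').
  have := le_dist_dist x x' (r (kappa x)) (r (kappa x')).
  have := le_dist_dist (r (kappa x)) (r (kappa x')) x x'.
  rewrite (enormB (r (kappa x)) x) (enormB (r (kappa x')) x') /h /=; lra.
pose kpi (z : (E * E) * (E * E)) := (kappa z.1.1, kappa z.2.1).
pose ka (z : E * E) := (kappa z.1, kappa z.2).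
have mkpi u : measurable (kpi @^-1` [set u]).
  rewrite (_ : kpi @^-1` [set u] =
      ((kappa \o fst) @^-1` [set u.1]) `*` ((kappa \o fst) @^-1` [set u.2])).
    by apply: measurableX; exact: mk0.
  by case: u => i j; apply/seteqP; split=> z /= [<- <-].
have mka u : measurable (ka @^-1` [set u]).
  rewrite (_ : ka @^-1` [set u] = A u.1 `*` A u.2); first by apply: measurableX; exact: mk.
  by case: u => i j; apply/seteqP; split=> z /= [<- <-].
have same : (\int[pi]_z (h (kpi z))%:E = \int[a]_z (h (ka z))%:E)%E.
  rewrite !integral_finite_map//; apply: eq_bigr => -[i j] _; congr (_ * _)%E.
  transitivity (a (A i `*` A j)).
    rewrite aE -piE; congr (pi _).
    by apply/seteqP; split=> z /= [<- <-].
  by congr (a _); apply/seteqP; split=> z /= [<- <-].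
have mX := compact_measurable_borel cX.
have aeX1 : {ae pi, forall z, X z.1.1}.
  apply: (@ae_fst R _ _ _ _ gamma0 gamma1 pi cpi (fst @^-1` X)).
    exact: measurable_preimage_fst.
  by rewrite c0.1.
have aeX2 : {ae pi, forall z, X z.2.1}.
  apply: (@ae_snd R _ _ _ _ gamma0 gamma1 pi cpi (fst @^-1` X)).
    exact: measurable_preimage_fst.
  by rewrite c1.1.
have e2 : 0 <= e / 2 by rewrite divr_ge0// ltW.
apply: (@le_trans _ _ (\int[pi]_z (h (kpi z) + e / 2)%:E)%E).
  apply: ae_ge0_le_integralT.
  - apply: measurable_enorm_sub; apply: measurableT_comp measurable_fst _.
      exact: measurable_fst.
    exact: measurable_snd.
  - by apply: measurable_funD => //; exact: (measurable_finite_map mkpi).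
  - by move=> z; exact: enorm_ge0.
  - by move=> z; rewrite addr_ge0.
  - by apply: (ae_imp2 aeX1 aeX2) => z X1 X2; exact: (close _ _ X1 X2).1.
rewrite ge0_integral_addcst//; last exact: (measurable_finite_map mkpi).
have -> : e%:E = ((e / 2)%:E + (e / 2)%:E)%E by rewrite -EFinD -splitr.
rewrite same addeA leeD2r//.
rewrite -ge0_integral_addcst//; last 2 first.
- exact: measurable_dist.
- by move=> z; exact: enorm_ge0.
apply: ae_ge0_le_integralT => //.
- exact: (measurable_finite_map mka).
- by apply: measurable_funD => //; exact: measurable_dist.
- by move=> z; rewrite addr_ge0// enorm_ge0.
apply: (ae_imp2 (ae_fst ca mX r0) (ae_snd ca mX r1)) => z X1 X2.
exact: (close _ _ X1 X2).2.
Qed.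

(** * The duality gap of the potentials of another pair of marginals *)

Lemma measurable_slopes_in (K : set V) (f : V -> R) : compact K ->
  slopes_in K f -> measurable_fun [set: E] (f : E -> R).
Proof.
move=> /compact_enorm_bounded [B _ KB] sf; apply: continuous_measurable_borel.
exact: lipschitz_enorm_continuous (slopes_in_lipschitz KB sf).
Qed.

(** The easy half of Kantorovich-Rubinstein duality, for nonnegative functions,
    whose integrals need no integrability condition. *)
Lemma integral_lipschitz_le rho0 rho1 (a : probability (E * E)%type R)
    (f : E -> R) (L : R) : 0 <= L ->
  coupling rho0 rho1 a -> measurable_fun setT f -> (forall x, 0 <= f x) ->
  (forall x x' : V, f x <= f x' + L * enorm (x - x')) ->
  (\int[rho0]_x (f x)%:E <= \int[rho1]_x (f x)%:E + L%:E * \int[a]_z (dist z)%:E)%E.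
Proof.
move=> L0 ca mf f0 lip.
have mfE : measurable_fun setT (EFin \o f) by exact/measurable_EFinP.
have f0E x : (0 <= (EFin \o f) x)%E by rewrite lee_fin.
have md : measurable_fun setT (EFin \o dist).
  by apply/measurable_EFinP; exact: measurable_dist.
rewrite -(ge0_integral_fst ca mfE f0E) -(ge0_integral_snd ca mfE f0E).
rewrite -ge0_integralZl//; last by move=> z _; rewrite lee_fin enorm_ge0.
rewrite -ge0_integralD//; last 3 first.
- exact: (measurableT_comp mfE measurable_snd).
- by move=> z _; rewrite mule_ge0 ?lee_fin ?enorm_ge0.
- by apply: measurable_funeM.
apply: ge0_le_integral => //.
- exact: (measurableT_comp mfE measurable_fst).
- apply: emeasurable_funD; first exact: (measurableT_comp mfE measurable_snd).
  by apply: measurable_funeM.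
- by move=> z _; rewrite -EFinM -EFinD lee_fin lip.
Qed.

(** The potentials [phi0], [psi0] of the first plan bound its correlation from
    above by duality; subtracting them makes the differences [phi1 - phi0] and
    [psi1 - psi0] appear, whose Lipschitz constants are the diameters of [Y]
    and [X], however far from the origin these sets are. *)
Lemma potential_gap_le (X Y : set V) rho0 mu0 rho1 mu1
    (gamma0 gamma1 a b : probability (E * E)%type R)
    (phi0 psi0 phi1 psi1 : V -> R) :
  compact X -> compact Y -> coupling rho0 mu0 gamma0 -> coupling rho1 mu1 gamma1 ->
  coupling rho0 rho1 a -> coupling mu0 mu1 b ->
  conjugate Y phi0 psi0 -> slopes_in X psi0 ->
  conjugate Y phi1 psi1 -> slopes_in X psi1 ->
  {ae gamma0, forall z, (X z.1 /\ Y z.2) /\ subgrad Y phi0 psi0 z.1 z.2} ->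
  {ae gamma1, forall z, (X z.1 /\ Y z.2) /\ subgrad Y phi1 psi1 z.1 z.2} ->
  (\int[gamma0]_z (`|phi1 z.1 + psi1 z.2 - dot (z.1 : V) z.2|)%:E <=
    (diam Y)%:E * \int[a]_z (dist z)%:E + (diam X)%:E * \int[b]_z (dist z)%:E)%E.
Proof.
move=> cX cY c0 c1 ca cb cj0 sl0 cj1 sl1 ae0 ae1.
have [x0 Xx0] : exists x, X x by have [z [[Xz _] _]] := ae_nonempty ae0; exists z.1.
have [y0 Yy0] : exists y, Y y by have [z [[_ Yz] _]] := ae_nonempty ae0; exists z.2.
have DX0 := diam_ge0 cX Xx0; have DY0 := diam_ge0 cY Yy0.
have lipf := slopes_in_sub_lipschitz cY (conjugate_slopes_in cj1) (conjugate_slopes_in cj0).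
have lipg := slopes_in_sub_lipschitz cX sl1 sl0.
pose f x := phi1 x - phi0 x; pose g y := psi1 y - psi0 y.
pose C1 := `|f x0| + diam Y * diam X; pose C2 := `|g y0| + diam X * diam Y.
have fC x : X x -> 0 <= f x + C1.
  move=> Xx; have := lipf x0 x; rewrite -/(f x0) -/(f x).
  have := ler_wpM2l DY0 (le_diam cX Xx0 Xx); have := ler_norm (- f x0).
  by rewrite normrN /C1; lra.
have gC y : Y y -> 0 <= g y + C2.
  move=> Yy; have := lipg y0 y; rewrite -/(g y0) -/(g y).
  have := ler_wpM2l DX0 (le_diam cY Yy0 Yy); have := ler_norm (- g y0).
  by rewrite normrN /C2; lra.
have C10 : 0 <= C1 by rewrite addr_ge0// mulr_ge0.
have C20 : 0 <= C2 by rewrite addr_ge0// mulr_ge0.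
(* Truncating makes the shifted differences nonnegative everywhere, and
   changes nothing on [X] and [Y]. *)
pose f' (x : E) := Num.max 0 (f x + C1); pose g' (y : E) := Num.max 0 (g y + C2).
have mphi0 := measurable_slopes_in cY (conjugate_slopes_in cj0).
have mphi1 := measurable_slopes_in cY (conjugate_slopes_in cj1).
have mpsi0 := measurable_slopes_in cX sl0.
have mpsi1 := measurable_slopes_in cX sl1.
have mf' : measurable_fun setT f'.
  by apply: measurable_maxr => //; apply: measurable_funD => //; exact: measurable_funB.
have mg' : measurable_fun setT g'.
  by apply: measurable_maxr => //; apply: measurable_funD => //; exact: measurable_funB.
have f'0 x : 0 <= f' x by rewrite le_max lexx.
have g'0 y : 0 <= g' y by rewrite le_max lexx.
have lipf' (x x' : V) : f' x <= f' x' + diam Y * enorm (x - x').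
  rewrite /f' ge_max addr_ge0 ?f'0 ?mulr_ge0 ?enorm_ge0//=.
  have := lipf x x'; rewrite -/(f x) -/(f x').
  have : f x' + C1 <= Num.max 0 (f x' + C1) by rewrite le_max lexx orbT.
  lra.
have lipg' (y y' : V) : g' y <= g' y' + diam X * enorm (y - y').
  rewrite /g' ge_max addr_ge0 ?g'0 ?mulr_ge0 ?enorm_ge0//=.
  have := lipg y y'; rewrite -/(g y) -/(g y').
  have : g y' + C2 <= Num.max 0 (g y' + C2) by rewrite le_max lexx orbT.
  lra.
have I1 := integral_lipschitz_le DY0 ca mf' f'0 lipf'.
have I2 := integral_lipschitz_le DX0 cb mg' g'0 lipg'.
pose G (z : E * E) := `|phi1 z.1 + psi1 z.2 - dot (z.1 : V) z.2|.
have mG : measurable_fun setT G.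
  apply: measurableT_comp => //; apply: measurable_funB; last first.
    by apply: measurable_dot; [exact: measurable_fst|exact: measurable_snd].
  by apply: measurable_funD; [exact: (measurableT_comp mphi1 measurable_fst)|
    exact: (measurableT_comp mpsi1 measurable_snd)].
pose h (z : E * E) := f' z.1 + g' z.2.
have mh : measurable_fun setT h.
  by apply: measurable_funD; [exact: (measurableT_comp mf' measurable_fst)|
    exact: (measurableT_comp mg' measurable_snd)].
have h0 z : 0 <= h z by rewrite addr_ge0.
have hE rho mu (ga : probability (E * E)%type R) : coupling rho mu ga ->
    (\int[ga]_z (h z)%:E = \int[rho]_x (f' x)%:E + \int[mu]_y (g' y)%:E)%E.
  move=> cga; have mf'E : measurable_fun setT (EFin \o f') by exact/measurable_EFinP.
  have mg'E : measurable_fun setT (EFin \o g') by exact/measurable_EFinP.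
  rewrite -(ge0_integral_fst cga mf'E) => [|x]; last by rewrite lee_fin.
  rewrite -(ge0_integral_snd cga mg'E) => [|x]; last by rewrite lee_fin.
  rewrite -ge0_integralD//.
  - by move=> z _; rewrite lee_fin.
  - exact: (measurableT_comp mf'E measurable_fst).
  - by move=> z _; rewrite lee_fin.
  - exact: (measurableT_comp mg'E measurable_snd).
have C0 : 0 <= C1 + C2 by rewrite addr_ge0.
have low : (\int[gamma0]_z (G z)%:E + (C1 + C2)%:E <= \int[gamma0]_z (h z)%:E)%E.
  rewrite -ge0_integral_addcst//; last by move=> z; rewrite normr_ge0.
  apply: ae_ge0_le_integralT => //; first by apply: measurable_funD.
    by move=> z; rewrite addr_ge0// normr_ge0.
  apply: (ae_imp ae0) => z [[Xz Yz] [_ e0]].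
  rewrite /G ger0_norm ?subr_ge0; last exact: cj1.1.
  have : f z.1 + C1 <= f' z.1 by rewrite le_max lexx orbT.
  have : g z.2 + C2 <= g' z.2 by rewrite le_max lexx orbT.
  by rewrite /h /f /g; lra.
have up : (\int[gamma1]_z (h z)%:E <= (C1 + C2)%:E)%E.
  apply: (@le_trans _ _ (\int[gamma1]_z (cst (C1 + C2) z)%:E)%E).
    apply: ae_ge0_le_integralT => //.
    apply: (ae_imp ae1) => z [[Xz Yz] [_ e1]].
    have -> : h z = (f z.1 + C1) + (g z.2 + C2).
      by rewrite /h /f' /g' !max_r// ?fC// gC.
    by have := cj0.1 z.1 z.2 Yz; rewrite /f /g /=; lra.
  by rewrite (integral_cst gamma1 measurableT (C1 + C2)%:E)/= probability_setT mule1.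
rewrite -(@leeD2rE _ (C1 + C2)%:E)//; apply: (le_trans low).
rewrite (hE _ _ _ c0); apply: (le_trans (leeD I1 I2)).
rewrite addeACA -(hE _ _ _ c1) addeC leeD2l//.
Qed.

End transport_of_plans.

(** * From the duality gap to the distance between the plans *)

Section pointwise.
Context {R : realType} {d : nat}.

(** For [z = x0 + eta *: u], [u] the direction of [y0 - y1], and [yz] a
    subgradient at [z], the vector [y0 - y1] is the sum of [yz - y1], bounded by
    the oscillation, and of [y0 - yz], whose component along [u] is bounded by the
    gap divided by [eta]: the affine function of slope [y0] through [x0] is below
    [phi] up to the gap. *)
Lemma subgrad_dist_le (Y : set 'rV[R]_d) phi psi (c x0 x1 y0 y1 : 'rV[R]_d) (r eta : R) :
  compact Y -> conjugate Y phi psi -> 0 < eta ->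
  enorm (x0 - c) + eta <= r -> enorm (x0 - x1) <= eta ->
  Y y0 -> subgrad Y phi psi x1 y1 ->
  enorm (y0 - y1) <= osc Y phi psi c r + (phi x0 + psi y0 - dot x0 y0) / eta.
Proof.
move=> cY cj eta0 x0r x01 Yy0 xy1; set G := phi x0 + psi y0 - _.
have G0 : 0 <= G by rewrite subr_ge0; exact: cj.1.
have r0 : 0 <= r by have := enorm_ge0 (x0 - c); lra.
have [n0|n0] := eqVneq (enorm (y0 - y1)) 0.
  by rewrite n0 addr_ge0 ?osc_ge0// divr_ge0// ltW.
have np : 0 < enorm (y0 - y1) by rewrite lt_def n0 enorm_ge0.
pose u := (enorm (y0 - y1))^-1 *: (y0 - y1).
have un : enorm u = 1 by rewrite enormZ normfV gtr0_norm// mulVf.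
have uy : dot u (y0 - y1) = enorm (y0 - y1).
  by rewrite dotZl -enorm_sqr expr2 mulKf.
pose z := x0 + eta *: u.
have [yz Yyz ez] := cj.2 z; have zy : subgrad Y phi psi z yz by split.
have zc : enorm (z - c) <= r.
  rewrite /z addrAC; apply: (le_trans (enormD _ _)).
  by rewrite enormZ un mulr1 gtr0_norm.
have x1c : enorm (x1 - c) <= r.
  apply: (le_trans (enorm_triangle x0 _ _)); rewrite enormB; lra.
have os := le_osc cY zy xy1 zc x1c.
have h1 := cj.1 z y0 Yy0; have h2 := subgrad_le cj x0 zy.
have h3 : dot u (yz - y1) <= osc Y phi psi c r.
  apply: (le_trans (dot_le_enorm _ _)); rewrite un mul1r; exact: os.
have h4 : eta * dot u (y0 - yz) <= G.
  move: h1 h2; rewrite /G /z !(dotBl, dotDl, dotBr, dotZl); lra.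
have h5 : dot u (y0 - yz) <= G / eta by rewrite ler_pdivlMr// mulrC.
rewrite -uy; have -> : dot u (y0 - y1) = dot u (yz - y1) + dot u (y0 - yz).
  by rewrite !dotBr; ring.
exact: lerD.
Qed.

Lemma powR_le_linear (D t q : R) : 0 <= t -> t <= D -> 1 <= q ->
  t `^ q <= D `^ (q - 1) * t.
Proof.
move=> t0 tD q1; have q0 : 0 < q by lra.
rewrite -(mulr_powRB1 t0 q0) mulrC; apply: ler_wpM2r => //.
by apply: ge0_ler_powR; rewrite ?nnegrE ?subr_ge0// (le_trans t0).
Qed.

End pointwise.

(** * Numerical constants *)

Section constants.
Context {R : realType}.

(** [beta_ratio_ge] eliminates the volumes of the unit balls. *)
Lemma c_ge n : (0 < n)%N ->
  12 * (6 ^+ n * (n.+1%:R * n.+2%:R)) <= c_ R n.+1.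
Proof.
move=> n0; have [bn _] := volume_ball (R := R) n.
have := beta_ratio_ge (R := R) n0; rewrite /c_ /= => h.
have d0 : 0 < n.+1%:R :> R by [].
have rat : 3 / 2 <= n.+1%:R * (beta R n.+1 / beta R n).
  by rewrite mulrA ler_pdivlMr.
have -> : 4 / 3 * (6 ^+ n.+1 * n.+1%:R ^+ 2 * n.+2%:R * beta R n.+1 / beta R n) =
   8 * (6 ^+ n * (n.+1%:R * n.+2%:R)) * (n.+1%:R * (beta R n.+1 / beta R n)).
  by rewrite exprS; field; rewrite gt_eqF.
have P0 : 0 <= 8 * (6 ^+ n * (n.+1%:R * n.+2%:R)) :> R.
  by rewrite !mulr_ge0// exprn_ge0.
have := ler_wpM2l P0 rat; lra.
Qed.

(** From one [n] to the next, the square of the left-hand side is multiplied by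
    [16 / 25 * (n + 2) / (n + 1)], less than [1]; it is [32 / 25] for [n = 1]. *)
Lemma sqrt_geometric_le n : (0 < n)%N ->
  Num.sqrt n.+1%:R * (4 / 5) ^+ n <= 4 / 3 :> R.
Proof.
move=> n0; have lhs0 : 0 <= Num.sqrt n.+1%:R * (4 / 5) ^+ n :> R.
  by rewrite mulr_ge0 ?sqrtr_ge0// exprn_ge0// divr_ge0.
have rhs0 : 0 <= 4 / 3 :> R by rewrite divr_ge0.
rewrite -(@ler_pXn2r _ 2)//.
rewrite (exprMn _ (Num.sqrt _)) sqr_sqrtr// -exprM mulnC exprM.
case: n n0 {lhs0} => // k _.
apply: (@le_trans _ _ (32 / 25)); last lra.
elim: k => [|k IH]; first by rewrite expr1; lra.
apply: le_trans IH; rewrite [(_ ^+ 2) ^+ k.+2]exprS.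
have x0 : 0 <= ((4 / 5 : R) ^+ 2) ^+ k.+1 by rewrite !exprn_ge0.
have k0 : 0 <= k%:R :> R by [].
have -> : k.+3%:R = k%:R + 3 :> R by rewrite -addn3 natrD.
have -> : k.+2%:R = k%:R + 2 :> R by rewrite -addn2 natrD.
nra.
Qed.

(** The factor [(4 / 5) ^+ n] gained on [6 ^+ n] by counting columns precisely
    absorbs the square root, which comes from the diagonal of the cells. *)
Lemma grid_constant_le n : (0 < n)%N ->
  18 * Num.sqrt n.+1%:R * n.+1%:R ^+ 2 * (24 / 5) ^+ n <= 2 * c_ R n.+1.
Proof.
move=> n0; have := c_ge n0; have := sqrt_geometric_le n0.
have -> : (24 / 5 : R) ^+ n = (4 / 5) ^+ n * 6 ^+ n.
  by rewrite -exprMn; congr (_ ^+ _); field.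
set u := Num.sqrt _ * _ => hu hc.
have -> : 18 * Num.sqrt n.+1%:R * n.+1%:R ^+ 2 * ((4 / 5) ^+ n * 6 ^+ n) =
  18 * u * (6 ^+ n * n.+1%:R ^+ 2) :> R by rewrite /u; ring.
have X0 : 0 <= 6 ^+ n * n.+1%:R ^+ 2 :> R by rewrite mulr_ge0// exprn_ge0.
have : 6 ^+ n * n.+1%:R ^+ 2 <= 6 ^+ n * (n.+1%:R * n.+2%:R) :> R.
  rewrite ler_wpM2l ?exprn_ge0// expr2 ler_wpM2l// ler_nat; lia.
nra.
Qed.

Lemma c_ge_pow n : (0 < n)%N -> 108 * 2 ^+ n.+1 <= c_ R n.+1.
Proof.
move=> n0; apply: le_trans (c_ge n0).
have h3 : 3 <= 3 ^+ n :> R.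
  by rewrite -[leLHS]expr1 ler_weXn2l// ler1n.
have -> : (6 : R) ^+ n = 2 ^+ n * 3 ^+ n by rewrite -exprMn; congr (_ ^+ _); ring.
have p0 : 0 < 2 ^+ n :> R by rewrite exprn_gt0.
have : 6 <= n.+1%:R * n.+2%:R :> R.
  by rewrite -natrM ler_nat; nia.
move=> h6; rewrite exprS.
have := ler_wpM2l (ltW p0) h3; set v := 2 ^+ n * 3 ^+ n => hv.
have v0 : 0 <= v by rewrite mulr_ge0// exprn_ge0.
nra.
Qed.

End constants.

(** * Upper bounds for integrals *)

Section integral_bounds.
Context d (T : measurableType d) (R : realType).
Variable P : probability T R.

Lemma integral_le_cst (f : T -> R) c : measurable_fun setT f ->
  (forall x, 0 <= f x) -> 0 <= c -> {ae P, forall x, f x <= c} ->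
  (\int[P]_x (f x)%:E <= c%:E)%E.
Proof.
move=> mf f0 c0 fc; apply: (@le_trans _ _ (\int[P]_x (cst c x)%:E)%E).
  exact: ae_ge0_le_integralT.
by rewrite (integral_cst P measurableT c%:E)/= probability_setT mule1.
Qed.

Lemma integral_le_scale (f g : T -> R) c b : measurable_fun setT f ->
  measurable_fun setT g -> (forall x, 0 <= f x) -> (forall x, 0 <= g x) -> 0 <= c ->
  {ae P, forall x, f x <= c * g x} -> (\int[P]_x (g x)%:E <= b%:E)%E ->
  (\int[P]_x (f x)%:E <= (c * b)%:E)%E.
Proof.
move=> mf mg f0 g0 c0 fg gb; apply: (@le_trans _ _ (\int[P]_x (c * g x)%:E)%E).
  by apply: ae_ge0_le_integralT => //; [exact: measurable_funM|move=> x; rewrite mulr_ge0].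
under eq_integral do rewrite EFinM.
rewrite ge0_integralZl//; first by rewrite EFinM lee_wpmul2l.
- by apply/measurable_EFinP.
- by move=> x _; rewrite lee_fin.
Qed.

Lemma integral_le_add (f g : T -> R) b c : measurable_fun setT f ->
  measurable_fun setT g -> (forall x, 0 <= f x) -> (forall x, 0 <= g x) ->
  (\int[P]_x (f x)%:E <= b%:E)%E -> (\int[P]_x (g x)%:E <= c%:E)%E ->
  (\int[P]_x (f x + g x)%:E <= (b + c)%:E)%E.
Proof.
move=> mf mg f0 g0 fb gc; under eq_integral do rewrite EFinD.
rewrite ge0_integralD//; first by rewrite EFinD leeD.
- by move=> x _; rewrite lee_fin.
- by apply/measurable_EFinP.
- by move=> x _; rewrite lee_fin.
- by apply/measurable_EFinP.
Qed.

End integral_bounds.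

(** * Integrated oscillation of the subdifferential *)

Section oscillation.
Context {R : realType} {n : nat}.
Local Notation V := 'rV[R]_n.+1.
Local Notation E := (borel_rV R n.+1).
Variables (X Y : set V) (M theta : R) (rho : probability E R).
Hypotheses (compact_X : compact X) (compact_Y : compact Y) (n_gt0 : (0 < n)%N).
Hypotheses (M_gt0 : 0 < M) (theta_gt0 : 0 < theta).
Hypothesis theta_le1 : theta <= 1.
Hypothesis rho_X : rho X = 1%E.
Local Notation p := (n.+1%:R - 1 + theta).
Hypothesis rho_ball : forall (x : V) (eta : R), 0 < eta ->
  (rho (eball x eta) <= (M * eta `^ p)%:E)%E.

Let p_gt0 : 0 < p.
Proof. by have := theta_gt0; have : 0 <= n%:R :> R by []; rewrite -[n.+1%:R]natr1; lra. Qed.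

Lemma ball_mass_ge1 (o : V) r : X o -> diam X < r -> 1 <= M * r `^ p.
Proof.
move=> Xo Xr; have r0 : 0 < r by apply: le_lt_trans Xr; exact: diam_ge0 Xo.
rewrite -lee_fin; apply: le_trans (rho_ball o r0); rewrite -rho_X.
apply: le_measure; rewrite ?inE.
- exact: compact_measurable_borel.
- exact: measurable_eball.
- by move=> x Xx; apply: le_lt_trans Xr; exact: le_diam.
Qed.

(** If [X] were a point, every ball around it would have mass [1], against the
    growth bound for small radii. *)
Lemma diam_gt0 : 0 < diam X.
Proof.
have [x0 Xx0] : exists x, X x.
  by have := ae_nonempty (ae_full (compact_measurable_borel compact_X) rho_X).
rewrite lt_def (diam_ge0 compact_X Xx0) andbT; apply/negP => /eqP X0.
pose r := ((2 * M)^-1) `^ p^-1.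
have M2 : 0 < (2 * M)^-1 by rewrite invr_gt0 mulr_gt0.
have r0 : diam X < r by rewrite X0 powR_gt0.
have := ball_mass_ge1 Xx0 r0.
rewrite /r -powRrM mulVf ?gt_eqF// powRr1 ?(ltW M2)// invfM mulrCA divff ?gt_eqF//.
lra.
Qed.

(** The ball of radius twice the diameter around a point of [X] has full mass,
    which bounds [M] below. As [c_] is large, the stability estimate is then
    trivial unless the scale [s] is small. *)
Lemma constant_ge108 : 108 <= c_ R n.+1 * M * diam X `^ p.
Proof.
have DX0 := diam_gt0.
have [x0 Xx0] : exists x, X x.
  by have := ae_nonempty (ae_full (compact_measurable_borel compact_X) rho_X).
have := @ball_mass_ge1 x0 (2 * diam X) Xx0; rewrite powRM ?(ltW DX0)// => h.
have h1 : 1 <= M * (2 `^ p * diam X `^ p) by apply: h; lra.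
have h2 : 2 `^ p <= 2 ^+ n.+1 :> R.
  by rewrite -powR_mulrn// ler_powR ?ler1n//; have := theta_le1; lra.
have Dp : 0 <= diam X `^ p by exact: powR_ge0.
have MD : 0 <= M * diam X `^ p by rewrite mulr_ge0// ltW.
have h3 : 1 <= 2 ^+ n.+1 * (M * diam X `^ p).
  by apply: (le_trans h1); rewrite mulrCA ler_wpM2r.
have := c_ge_pow (R := R) n_gt0; nra.
Qed.

Variables (phi psi : V -> R).
Hypothesis conj : conjugate Y phi psi.
Variables (o : V) (s : R) (K : nat).
Hypotheses (Xo : X o) (s_gt0 : 0 < s) (s_small : 144 * s <= 1).
Hypothesis K_large : forall x, X x -> forall i, `|x 0 i - o 0 i| <= mesh X s * K%:R.
Local Notation eta := (s * diam X).
Local Notation cell := (cell_index o (mesh X s) K).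
Local Notation center := (cell_center o (mesh X s)).

Let DX0 := diam_gt0.
Let mesh0 : 0 < mesh X s := mesh_gt0 DX0 s_gt0.

Lemma cell_dist x : X x -> enorm (x - center (cell x)) <= 9 / 10 * eta.
Proof.
move=> Xx; apply: in_cell_dist => // i.
by apply: cell_index_dist => // j; exact: K_large.
Qed.

Lemma cell_mass_le m :
  (rho (cell @^-1` [set m]) <= (if `[< exists2 x, X x & in_cell X o s m x >]
     then M * eta `^ p else 0)%:E)%E.
Proof.
have mX := compact_measurable_borel compact_X.
have mm : measurable (cell @^-1` [set m] : set E) := measurable_cell o mesh0 m.
rewrite (full_setI mm mX rho_X) setIC.
have e0 : 0 < eta by rewrite mulr_gt0.
case: asboolP => [_|no]; last first.
  rewrite (_ : _ `&` _ = set0) ?measure0//; apply/seteqP; split=> x //= [Xx xm].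
  apply: no; exists x => // i; rewrite -xm.
  by apply: cell_index_dist => // j; exact: K_large.
apply: le_trans (rho_ball (center m) e0); apply: le_measure; rewrite ?inE.
- exact: measurableI.
- exact: measurable_eball.
by move=> x [Xx <-]; rewrite /eball /=; have := cell_dist Xx; lra.
Qed.

(** The mass of a cell contributes [s ^+ n * s `^ theta], and the sum of the
    oscillations over the cells at most a multiple of [s^-1 ^+ n]. *)
Lemma integral_osc_le :
  (\int[rho]_x (osc Y phi psi (center (cell x)) (2 * eta))%:E <=
    (2 * (c_ R n.+1 * M * diam X `^ p) * s `^ theta * diam Y)%:E)%E.
Proof.
have e0 : 0 < eta by rewrite mulr_gt0.
have [y0 Yy0 _] := conj.2 o; have DY0 := diam_ge0 compact_Y Yy0.
pose h (m : {ffun 'I_n.+1 -> 'I_K.*2.+1}) := osc Y phi psi (center m) (2 * eta).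
have h0 m : 0 <= h m by apply: osc_ge0 => //; rewrite mulr_ge0// ltW.
rewrite (@integral_finite_map _ _ _ rho _ cell _ h h0); last first.
  by move=> m; exact: measurable_cell.
apply: (@le_trans _ _ (\sum_m (if `[< exists2 x, X x & in_cell X o s m x >]
    then M * eta `^ p * h m else 0)%:E)%E).
  apply: lee_sum => m _; have := cell_mass_le m.
  case: asboolP => _ hm.
    by rewrite mulrC EFinM lee_wpmul2l// lee_fin.
  by rewrite (le_trans (lee_wpmul2l _ hm)) ?mule0// lee_fin.
rewrite sumEFin -big_mkcond/= -mulr_sumr lee_fin.
have e1 : 0 <= M * eta `^ p by rewrite mulr_ge0 ?powR_ge0// ltW.
apply: (le_trans (ler_wpM2l e1 (grid_osc_le compact_X compact_Y conj K Xo DX0 n_gt0 s_gt0 s_small))).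
have -> : eta `^ p = s ^+ n * s `^ theta * diam X `^ p.
  rewrite powRM ?(ltW s_gt0) ?(ltW DX0)//; congr (_ * _).
  have -> : p = n%:R + theta by rewrite -[n.+1%:R]natr1; ring.
  rewrite powRD; last by rewrite (gt_eqF s_gt0) implybT.
  by rewrite powR_mulrn// ltW.
rewrite expr_div_n.
have -> : M * (s ^+ n * s `^ theta * diam X `^ p) *
   (18 * Num.sqrt n.+1%:R * n.+1%:R ^+ 2 * ((24 / 5) ^+ n / s ^+ n) * diam Y) =
   (18 * Num.sqrt n.+1%:R * n.+1%:R ^+ 2 * (24 / 5) ^+ n) *
   (M * diam X `^ p * s `^ theta * diam Y).
  by field; rewrite expf_neq0// gt_eqF.
have W0 : 0 <= M * diam X `^ p * s `^ theta * diam Y.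
  by rewrite !mulr_ge0 ?powR_ge0// ltW.
apply: (le_trans (ler_wpM2r W0 (grid_constant_le n_gt0))).
by rewrite le_eqVlt; apply/orP; left; apply/eqP; ring.
Qed.

End oscillation.

(** * Stability of optimal plans *)

Section arithmetic.
Context {R : realType}.
Implicit Types DX DY mx w sg k : R.

Lemma one_le_scale sg k : 108 <= k -> 1 <= 144 * sg -> 1 <= 2 * sg * (1 + k).
Proof. by move=> k108 sg1; nra. Qed.

Lemma add_halves_lt (v0 v1 w del0 del1 : R) :
  del0 < v0 + (w - (v0 + v1)) / 2 -> del1 < v1 + (w - (v0 + v1)) / 2 -> del0 + del1 < w.
Proof. lra. Qed.

Lemma near_center (a eta : R) : 0 <= eta -> a <= 9 / 10 * eta -> a + eta <= 2 * eta.
Proof. lra. Qed.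

Lemma gap_le_scale DX DY mx w (del0 del1 : R) : 0 <= del0 -> 0 <= del1 ->
  del0 + del1 < w -> 0 <= mx -> DX <= mx -> DY <= mx -> DY * del0 + DX * del1 <= mx * w.
Proof.
move=> del0_ge0 del1_ge0 dw mx0 DXmx DYmx.
have := ler_wpM2r del0_ge0 DYmx; have := ler_wpM2r del1_ge0 DXmx.
have := ler_wpM2l mx0 (ltW dw); lra.
Qed.

End arithmetic.

Section stability.
Context {R : realType} {n : nat}.
Local Notation V := 'rV[R]_n.+1.
Local Notation E := (borel_rV R n.+1).
Variables (q : R) (X Y : set V) (M theta : R) (rho0 mu0 rho1 mu1 : probability E R).
Variables (gamma0 gamma1 : probability (E * E)%type R).
Hypotheses (n_gt0 : (0 < n)%N) (q_ge1 : 1 <= q).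
Hypotheses (compact_X : compact X) (compact_Y : compact Y) (DY0 : 0 < diam Y).
Hypotheses (M_gt0 : 0 < M) (theta_gt0 : 0 < theta) (theta_le1 : theta <= 1).
Local Notation p := (n.+1%:R - 1 + theta).
Hypothesis rho0_X : rho0 X = 1%E.
Hypothesis rho0_ball : forall (x : V) (eta : R), 0 < eta ->
  (rho0 (eball x eta) <= (M * eta `^ p)%:E)%E.
Hypothesis mu0_Y : mu0 Y = 1%E.
Hypothesis rho1_X : rho1 X = 1%E.
Hypothesis mu1_Y : mu1 Y = 1%E.
Hypothesis gamma0_opt : Gamma rho0 mu0 gamma0.
Hypothesis gamma1_opt : Gamma rho1 mu1 gamma1.

Let DX0 : 0 < diam X :=
  diam_gt0 compact_X M_gt0 theta_gt0 rho0_X rho0_ball.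

Local Notation distX := (fun z : (E * E) * (E * E) => enorm (z.1.1 - z.2.1 : V)).
Local Notation distY := (fun z : (E * E) * (E * E) => enorm (z.1.2 - z.2.2 : V)).
Local Notation DX := (diam X).
Local Notation DY := (diam Y).

Lemma measurable_distX : measurable_fun setT distX.
Proof.
apply: measurable_enorm_sub; first exact: (measurableT_comp measurable_fst measurable_fst).
exact: (measurableT_comp measurable_fst measurable_snd).
Qed.

Lemma measurable_distY : measurable_fun setT distY.
Proof.
apply: measurable_enorm_sub; first exact: (measurableT_comp measurable_snd measurable_fst).
exact: (measurableT_comp measurable_snd measurable_snd).
Qed.

Lemma measurable_pow d (T : measurableType d) (f : T -> R) :
  measurable_fun setT f -> measurable_fun setT (fun x => f x `^ q).
Proof. by move=> mf; exact: (measurableT_comp (measurable_powR q) mf). Qed.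

Section with_coupling.
Variable pi : probability ((E * E) * (E * E))%type R.
Hypothesis cpl : coupling gamma0 gamma1 pi.

Let aeXX : {ae pi, forall z, X z.1.1 /\ X z.2.1}.
Proof.
have mX := compact_measurable_borel compact_X.
have h0 := ae_marginal_fst cpl (ae_fst gamma0_opt.1 mX rho0_X).
have h1 := ae_marginal_snd cpl (ae_fst gamma1_opt.1 mX rho1_X).
by apply: (ae_imp2 h0 h1) => z; exact: conj.
Qed.

Let aeYY : {ae pi, forall z, Y z.1.2 /\ Y z.2.2}.
Proof.
have mY := compact_measurable_borel compact_Y.
have h0 := ae_marginal_fst cpl (ae_snd gamma0_opt.1 mY mu0_Y).
have h1 := ae_marginal_snd cpl (ae_snd gamma1_opt.1 mY mu1_Y).
by apply: (ae_imp2 h0 h1) => z; exact: conj.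
Qed.

Let q0 : 0 <= q := le_trans ler01 q_ge1.

Lemma integral_distX_trivial : (\int[pi]_z (distX z `^ q)%:E <= (DX `^ q)%:E)%E.
Proof.
apply: integral_le_cst => //.
- exact: measurable_pow measurable_distX.
- by move=> z; exact: powR_ge0.
- exact: powR_ge0.
apply: (ae_imp aeXX) => z [X0 X1].
by apply: ge0_ler_powR; rewrite ?nnegrE ?enorm_ge0 ?(ltW DX0)//; exact: le_diam.
Qed.

Lemma integral_distY_trivial : (\int[pi]_z (distY z `^ q)%:E <= (DY `^ q)%:E)%E.
Proof.
apply: integral_le_cst => //.
- exact: measurable_pow measurable_distY.
- by move=> z; exact: powR_ge0.
- exact: powR_ge0.
apply: (ae_imp aeYY) => z [Y0 Y1].
by apply: ge0_ler_powR; rewrite ?nnegrE ?enorm_ge0 ?(ltW DY0)//; exact: le_diam.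
Qed.

Variable d' : R.
Hypothesis d'P : (\int[pi]_z (distX z)%:E <= d'%:E)%E.

Lemma integral_distX_le :
  (\int[pi]_z (distX z `^ q)%:E <= (DX `^ (q - 1) * d')%:E)%E.
Proof.
apply: (integral_le_scale (g := distX)) => //.
- exact: measurable_pow measurable_distX.
- exact: measurable_distX.
- by move=> z; exact: powR_ge0.
- by move=> z; exact: enorm_ge0.
- exact: powR_ge0.
apply: (ae_imp aeXX) => z [X0 X1].
by apply: powR_le_linear => //; [exact: enorm_ge0|exact: le_diam].
Qed.

Variables (phi psi : V -> R) (g s : R).
Hypothesis cj : conjugate Y phi psi.
Hypothesis sl : slopes_in X psi.
Hypothesis sub1 : {ae gamma1, forall z, (X z.1 /\ Y z.2) /\ subgrad Y phi psi z.1 z.2}.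
Local Notation gap := (fun z : E * E => `|phi z.1 + psi z.2 - dot (z.1 : V) z.2|).
Hypothesis gP : (\int[gamma0]_z (gap z)%:E <= g%:E)%E.
Hypotheses (s_gt0 : 0 < s) (s_small : 144 * s <= 1).
Local Notation eta := (s * DX).

(** The distance of the second coordinates is bounded by [subgrad_dist_le] when
    the first coordinates are at distance at most [eta], and by [diam Y]
    otherwise. *)
Lemma integral_distY_le :
  (\int[pi]_z (distY z `^ q)%:E <=
    (DY `^ (q - 1) * (2 * (c_ R n.+1 * M * DX `^ p) * s `^ theta * DY +
      (eta^-1 * g + DY / eta * d')))%:E)%E.
Proof.
have e0 : 0 < eta by rewrite mulr_gt0.
have [x0 Xx0] : exists x, X x.
  by have := ae_nonempty (ae_full (compact_measurable_borel compact_X) rho0_X).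
(* [K] is large enough for the grid centred at [x0] to cover [X]. *)
have mesh0 : 0 < mesh X s := mesh_gt0 DX0 s_gt0.
pose K := (Num.trunc (DX / mesh X s)).+1.
have K_large x : X x -> forall i, `|x 0 i - x0 0 i| <= mesh X s * K%:R.
  move=> Xx i; have -> : x 0 i - x0 0 i = (x - x0) 0 i by rewrite !mxE.
  apply: (le_trans (coord_le_enorm _ _)); apply: (le_trans (le_diam compact_X Xx Xx0)).
  rewrite mulrC -ler_pdivrMr//; apply/ltW.
  by have /andP[] := truncn_itv (divr_ge0 (ltW DX0) (ltW mesh0)).
pose cell := cell_index x0 (mesh X s) K.
pose h m := osc Y phi psi (cell_center x0 (mesh X s) (K := K) m) (2 * eta).
pose A (x : E) := h (cell x).
have A0 x : 0 <= A x by apply: osc_ge0 => //; rewrite mulr_ge0// ltW.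
have mA : measurable_fun setT A.
  by apply: (measurable_finite_map (kappa := cell : E -> _)) => m; exact: measurable_cell.
have mgap : measurable_fun setT gap.
  apply: measurableT_comp => //; apply: measurable_funB; last first.
    by apply: measurable_dot; [exact: measurable_fst|exact: measurable_snd].
  have mphi := measurable_slopes_in compact_Y (conjugate_slopes_in cj).
  have mpsi := measurable_slopes_in compact_X sl.
  by apply: measurable_funD; [exact: (measurableT_comp mphi measurable_fst)|
    exact: (measurableT_comp mpsi measurable_snd)].
have mA11 : measurable_fun setT (fun z : (E * E) * (E * E) => A z.1.1).
  exact: (measurableT_comp mA (measurableT_comp measurable_fst measurable_fst)).
have mgap1 : measurable_fun setT (fun z : (E * E) * (E * E) => gap z.1).
  exact: (measurableT_comp mgap measurable_fst).
pose B (z : (E * E) * (E * E)) := eta^-1 * gap z.1 + DY / eta * distX z.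
have ei : 0 <= eta^-1 by rewrite invr_ge0 ltW.
have De : 0 <= DY / eta by rewrite divr_ge0// ltW.
have gap0 z : 0 <= eta^-1 * gap z by rewrite mulr_ge0// normr_ge0.
have dX0 (z : (E * E) * (E * E)) : 0 <= DY / eta * distX z by rewrite mulr_ge0// enorm_ge0.
have B0 z : 0 <= B z by rewrite addr_ge0.
have mB : measurable_fun setT B.
  by apply: measurable_funD; apply: measurable_funM => //; exact: measurable_distX.
apply: (integral_le_scale (g := fun z => A z.1.1 + B z)) => //.
- exact: measurable_pow measurable_distY.
- exact: measurable_funD.
- by move=> z; exact: powR_ge0.
- by move=> z; rewrite addr_ge0.
- exact: powR_ge0.
- have sub1' := ae_marginal_snd cpl sub1.
  apply: (ae_imp2 (ae_imp2 aeXX aeYY (fun z => @conj _ _)) sub1').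
  move=> z [[X0 X1] [Y0 Y1]] [_ sg].
  apply: (le_trans (powR_le_linear (enorm_ge0 _) (le_diam compact_Y Y0 Y1) q_ge1)).
  apply: ler_wpM2l; first exact: powR_ge0.
  have [near|far] := leP (distX z) eta.
    have := @subgrad_dist_le R n.+1 Y phi psi (cell_center x0 (mesh X s) (cell z.1.1))
      z.1.1 z.2.1 z.1.2 z.2.2 (2 * eta) eta compact_Y cj e0.
    have := cell_dist compact_X M_gt0 theta_gt0 rho0_X rho0_ball s_gt0 K_large X0.
    rewrite -/cell => cd /(_ _ near Y0 sg) main.
    apply: (le_trans (main _)); first exact: near_center (ltW e0) cd.
    rewrite -/(h _) -/(A _) /B lerD2l.
    have := ler_norm (phi z.1.1 + psi z.1.2 - dot (z.1.1 : V) z.1.2).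
    move=> /(ler_wpM2l ei); rewrite [X in X <= _ -> _]mulrC => /le_trans; apply.
    by rewrite lerDl.
  apply: (le_trans (le_diam compact_Y Y0 Y1)).
  have : DY <= DY / eta * distX z.
    by rewrite -mulrA ler_peMr ?(ltW DY0)// mulrC ler_pdivlMr// mul1r ltW.
  move=> /le_trans; apply; rewrite /B addrA lerDr.
  exact: addr_ge0 (A0 _) (gap0 _).
apply: integral_le_add => //.
  have mAE : measurable_fun setT (EFin \o A) by apply/measurable_EFinP; exact: mA.
  have A0E x : (0 <= (EFin \o A) x)%E by rewrite lee_fin.
  have mA1E : measurable_fun setT (fun z : E * E => (A z.1)%:E).
    exact: (measurableT_comp mAE measurable_fst).
  rewrite (ge0_integral_fst cpl mA1E); last by move=> z; rewrite lee_fin.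
  rewrite (ge0_integral_fst gamma0_opt.1 mAE A0E).
  exact: (integral_osc_le compact_X compact_Y n_gt0 M_gt0 theta_gt0 rho0_X rho0_ball
    cj Xx0 s_gt0 s_small K_large).
apply: integral_le_add => //.
- exact: measurable_funM.
- by apply: measurable_funM => //; exact: measurable_distX.
- apply: (integral_le_scale (g := fun z : (E * E) * (E * E) => gap z.1)) => //.
  + exact: measurable_funM.
  + by apply: aeW => z.
  rewrite (ge0_integral_fst cpl (f := fun z => (gap z)%:E))//.
  by apply/measurable_EFinP.
apply: (integral_le_scale (g := distX)) => //.
- by apply: measurable_funM => //; exact: measurable_distX.
- exact: measurable_distX.
- by move=> z; exact: enorm_ge0.
- by apply: aeW => z.
Qed.

End with_coupling.

Lemma W1_ge0 (P1 P2 : probability E R) : (0 <= W1 P1 P2)%E.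
Proof.
apply: le_ereal_inf_tmp => _ [pi _ <-]; apply: integral_ge0 => z _.
by rewrite lee_fin enorm_ge0.
Qed.

Lemma W1_near_optimal (P1 P2 : probability E R) (v : R) : (W1 P1 P2 < v%:E)%E ->
  exists (pi : probability (E * E)%type R) (delta : R),
    [/\ coupling P1 P2 pi, 0 <= delta, delta < v &
        (\int[pi]_z (enorm (z.1 - z.2 : V))%:E)%E = delta%:E].
Proof.
move=> /ereal_inf_lt [_ [pi cpi <-]] lt.
have ge0 : (0 <= \int[pi]_z (enorm (z.1 - z.2 : V))%:E)%E.
  by apply: integral_ge0 => z _; rewrite lee_fin enorm_ge0.
have fin : (\int[pi]_z (enorm (z.1 - z.2 : V))%:E)%E \is a fin_num.
  by rewrite ge0_fin_numE// (lt_trans lt) ?ltry.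
exists pi, (fine (\int[pi]_z (enorm (z.1 - z.2 : V))%:E)); split=> //.
- exact: fine_ge0.
- by rewrite -lte_fin fineK.
- by rewrite fineK.
Qed.

Local Notation e := (theta / (1 + theta)).
Local Notation B := (DX `^ q + DY `^ q * (1 + c_ R n.+1 * M * DX `^ p)).

(** The choice of [s] makes the three contributions to the distance of the second
    coordinates proportional to [s `^ theta = t `^ e]. Nearly optimal couplings
    of the marginals suffice, since [w] exceeds the sum of the distances. *)
Lemma transport_cost_le (w : R) : (W1 rho0 rho1 + W1 mu0 mu1 < w%:E)%E ->
  (transport_cost (fun z : (E * E) * (E * E) => (distX z `^ q + distY z `^ q)%R)
     gamma0 gamma1 <=
   (2 * (Num.max DX DY * w / (DX * DY)) `^ e * B)%:E)%E.
Proof.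
move=> Ww.
have [v0 W0E] : exists v, W1 rho0 rho1 = v%:E.
  exists (fine (W1 rho0 rho1)); rewrite fineK// ge0_fin_numE ?W1_ge0//.
  by apply: le_lt_trans (lt_trans Ww (ltry _)); rewrite leeDl// W1_ge0.
have [v1 W1E] : exists v, W1 mu0 mu1 = v%:E.
  exists (fine (W1 mu0 mu1)); rewrite fineK// ge0_fin_numE ?W1_ge0//.
  by apply: le_lt_trans (lt_trans Ww (ltry _)); rewrite leeDr// W1_ge0.
rewrite W0E W1E -EFinD lte_fin in Ww.
pose eps := (w - (v0 + v1)) / 2; have eps0 : 0 < eps by rewrite divr_gt0// subr_gt0.
have [|a [del0 [ca del0_ge0 del0_lt aE]]] := @W1_near_optimal rho0 rho1 (v0 + eps).
  by rewrite W0E lte_fin; lra.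
have [|b [del1 [cb del1_ge0 del1_lt bE]]] := @W1_near_optimal mu0 mu1 (v1 + eps).
  by rewrite W1E lte_fin; lra.
have dw : del0 + del1 < w := add_halves_lt del0_lt del1_lt.
(* The room between [del0 + del1] and [w] pays for the gluing. *)
have tau0 : 0 < w - del1 - del0 by rewrite -addrA -opprD subr_gt0 addrC.
have [pi cpl] := coupling_of_plans compact_X rho0_X rho1_X tau0
  gamma0_opt.1 gamma1_opt.1 ca.
rewrite aE -EFinD addrC subrK => piX.
have [phi0 [psi0 [cj0 sl0 ae0]]] :=
  optimal_potentials compact_X compact_Y gamma0_opt rho0_X mu0_Y.
have [phi1 [psi1 [cj1 sl1 ae1]]] :=
  optimal_potentials compact_X compact_Y gamma1_opt rho1_X mu1_Y.
have := potential_gap_le compact_X compact_Y gamma0_opt.1 gamma1_opt.1 ca cb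
  cj0 sl0 cj1 sl1 ae0 ae1.
rewrite aE bE -!EFinM -EFinD => gapP.
set mx := Num.max DX DY; pose t := mx * w / (DX * DY).
have w0 : 0 < w := le_lt_trans (addr_ge0 del0_ge0 del1_ge0) dw.
have del1w : 0 <= w - del1.
  by rewrite subr_ge0 (le_trans _ (ltW dw))// lerDr.
have mx0 : 0 < mx by rewrite lt_max DX0.
have t0 : 0 < t by rewrite divr_gt0 ?mulr_gt0.
have DXmx : DX <= mx by rewrite le_max lexx.
have DYmx : DY <= mx by rewrite le_max lexx orbT.
have tE : mx * w = t * DX * DY by rewrite /t; field; rewrite !gt_eqF.
have th1 : 0 < 1 + theta by rewrite addr_gt0.
pose s := t `^ (1 + theta)^-1.
have s0 : 0 < s by exact: powR_gt0.
have sth : s `^ theta = t `^ e by rewrite -powRrM mulrC.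
have st : s * s `^ theta = t.
  rewrite -[X in X * _]powRr1 ?(ltW s0)// -powRD ?(gt_eqF s0) ?implybT//.
  by rewrite -powRrM mulVf ?gt_eqF// powRr1// ltW.
set sg := s `^ theta in sth st.
have sg0 : 0 < sg by exact: powR_gt0.
have sg1 : 1 <= s -> 1 <= sg.
  move=> s1; have one : 1 `^ theta = 1 :> R by rewrite powR1.
  by rewrite -[leLHS]one; apply: ge0_ler_powR; rewrite ?nnegrE// ltW.
have sgs : s <= 1 -> s <= sg.
  by move=> s1; apply: ger1_powR => //; rewrite s0.
have boundX : (\int[pi]_z (distX z `^ q)%:E <= (DX `^ q * sg)%:E)%E.
  have DXq : 0 < DX `^ q by exact: powR_gt0.
  have [s1|s1] := leP s 1; last first.
    apply: (le_trans (integral_distX_trivial cpl)); rewrite lee_fin.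
    by rewrite ler_peMr ?sg1// ltW.
  apply: (le_trans (integral_distX_le cpl piX)); rewrite lee_fin.
  have q0 : 0 < q := lt_le_trans ltr01 q_ge1.
  rewrite -[in leRHS](mulr_powRB1 (ltW DX0) q0).
  have u0 : 0 < DX `^ (q - 1) by exact: powR_gt0.
  rewrite [leRHS](_ : _ = DX `^ (q - 1) * (sg * DX)); last by ring.
  rewrite ler_pM2l//.
  have : w - del1 <= t * DX.
    rewrite -(ler_pM2r DY0) -tE [leRHS]mulrC.
    by apply: ler_pM; rewrite ?(ltW DY0) ?gerBl.
  move=> /le_trans; apply; rewrite ler_pM2r// -st ler_piMl//; exact: ltW.
have c108 := constant_ge108 compact_X n_gt0 M_gt0 theta_gt0 theta_le1 rho0_X rho0_ball.
have boundY : (\int[pi]_z (distY z `^ q)%:E <=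
    (2 * sg * (DY `^ q * (1 + c_ R n.+1 * M * DX `^ p)))%:E)%E.
  have DYq : 0 < DY `^ q by exact: powR_gt0.
  (* For large [s] the trivial bound by [diam Y] is enough, as
     [c108] makes the right-hand side at least as large. *)
  have [s1|s1] := leP (144 * s) 1; last first.
    apply: (le_trans (integral_distY_trivial cpl)); rewrite lee_fin.
    rewrite mulrCA ler_peMr ?(ltW DYq)//.
    apply: one_le_scale => //; have [/sgs ssg|/ltW/sg1 ssg] := leP s 1.
      by apply: (le_trans (ltW s1)); rewrite ler_pM2l.
    by apply: (le_trans ssg); rewrite ler_peMl ?(ltW sg0)// ler1n.
  apply: (le_trans (integral_distY_le cpl piX cj1 sl1 ae1 gapP s0 s1)); rewrite lee_fin.
  have q0 : 0 < q := lt_le_trans ltr01 q_ge1.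
  rewrite -[in leRHS](mulr_powRB1 (ltW DY0) q0) -/sg.
  have u0 : 0 < DY `^ (q - 1) by exact: powR_gt0.
  rewrite [leRHS](_ : _ = DY `^ (q - 1) *
    (2 * (c_ R n.+1 * M * DX `^ p) * sg * DY + (DY * sg + DY * sg))); last by ring.
  rewrite ler_pM2l// lerD2l.
  have eta0 : 0 < s * DX by rewrite mulr_gt0.
  have tS : mx * w = DY * sg * (s * DX) by rewrite tE -st; ring.
  apply: lerD.
    rewrite mulrC ler_pdivrMr// -tS.
    by apply: gap_le_scale => //; exact: ltW.
  rewrite mulrAC ler_pdivrMr// -tS.
  by apply: ler_pM; rewrite ?(ltW DY0) ?gerBl.
apply: (@le_trans _ _ (\int[pi]_z (distX z `^ q + distY z `^ q)%:E)%E).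
  by apply: ereal_inf_lbound; exists pi.
apply: (le_trans (integral_le_add _ _ _ _ boundX boundY)).
- exact: measurable_pow measurable_distX.
- exact: measurable_pow measurable_distY.
- by move=> z; exact: powR_ge0.
- by move=> z; exact: powR_ge0.
rewrite lee_fin -sth -/sg.
rewrite [leRHS]mulrDr lerD2r mulrC.
by apply: ler_wpM2r; [exact: powR_ge0|rewrite ler_peMl ?(ltW sg0) ?ler1n].
Qed.

End stability.

(** * Exponents and constants *)

Section exponents.
Context {R : realType}.
Variables (n : nat) (q M theta DX DY : R).
Hypotheses (q_ge1 : 1 <= q) (theta_gt0 : 0 < theta) (DX0 : 0 < DX) (DY0 : 0 < DY).
Local Notation e := (theta / (1 + theta)).
Local Notation k := (c_ R n.+1 * M * DX `^ (n.+1%:R - 1 + theta)).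
Hypothesis k_ge0 : 0 <= k.
Local Notation B := (DX `^ q + DY `^ q * (1 + k)).

Let q0 : 0 < q := lt_le_trans ltr01 q_ge1.
Let B0 : 0 < B.
Proof.
by rewrite addr_gt0 ?powR_gt0// mulr_gt0 ?powR_gt0// ltr_wpDr.
Qed.

(** Both summands have the factor [(DX * DY) `^ (- e)], because
    [q - 1 + (1 + theta)^-1 = q - e]. *)
Lemma C'_E : C'_ n.+1 q M theta DX DY = (B * (DX * DY) `^ (- e)) `^ q^-1.
Proof.
rewrite /C'_; congr (_ `^ _); rewrite mulrDl [DY * DX]mulrC; congr (_ + _).
rewrite powRM ?ltW// mulrA; congr (_ * _).
rewrite -powRD ?(gt_eqF DX0) ?implybT//; congr (_ `^ _).
by field; rewrite gt_eqF// addr_gt0.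
Qed.

Lemma C_gt0 : 0 < C_ n.+1 q M theta DX DY.
Proof.
rewrite /C_ C'_E !mulr_gt0 ?powR_gt0 ?lt_max ?DX0//.
by rewrite mulr_gt0// powR_gt0// mulr_gt0.
Qed.

(** The factor [2] leaves the root as [2 `^ q^-1], which is at most [2]. *)
Lemma root_cost_le (w : R) : 0 <= w ->
  (2 * (Num.max DX DY * w / (DX * DY)) `^ e * B) `^ q^-1 <=
  C_ n.+1 q M theta DX DY * w `^ (theta / (q * (1 + theta))).
Proof.
move=> w0; set mx := Num.max DX DY.
have mx0 : 0 <= mx by rewrite le_max (ltW DX0).
have D0 : 0 <= DX * DY by rewrite mulr_ge0// ltW.
have rE : theta / (q * (1 + theta)) = e * q^-1.
  by rewrite invfM mulrA mulrAC.
rewrite /C_ C'_E -/mx rE (powRrM mx e) (powRrM w e).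
set I := B * _; have I0 : 0 <= I by rewrite mulr_ge0 ?powR_ge0// ltW.
have -> : 2 * (mx * w / (DX * DY)) `^ e * B = 2 * (mx `^ e * (w `^ e * I)).
  have inv : (DX * DY)^-1 `^ e = (DX * DY) `^ (- e).
    by rewrite -[X in X `^ e](powR_inv1 D0) -powRrM mulN1r.
  rewrite (@powRM _ (mx * w)) ?invr_ge0 ?mulr_ge0 ?(ltW DX0) ?(ltW DY0) ?(@powRM _ mx w)// inv /I.
  by ring.
have root x y z : 0 <= x -> 0 <= y -> 0 <= z ->
    (2 * (x * (y * z))) `^ q^-1 = 2 `^ q^-1 * (x `^ q^-1 * (y `^ q^-1 * z `^ q^-1)).
  by move=> x0 y0 z0; rewrite !powRM ?mulr_ge0.
rewrite root ?powR_ge0//.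
set a := (mx `^ e) `^ _; set b := (w `^ e) `^ _; set c := I `^ _.
rewrite [leRHS](_ : _ = 2 * (a * (b * c))); last by rewrite -!mulrA [c * b]mulrC.
apply: ler_wpM2r; first by rewrite !mulr_ge0 ?powR_ge0.
rewrite -[leRHS]powRr1//; apply: ler_powR; first by rewrite ler1n.
by rewrite invf_le1.
Qed.

End exponents.

Theorem theorem4p8 (R : realType) (d : nat) (q : R) (X Y : set 'rV[R]_d)
    (M theta : R) (rho0 mu0 : probability (borel_rV R d) R)
    (gamma0 : probability (borel_rV R d * borel_rV R d)%type R)
    (d_ge2 : (2 <= d)%N) (q_ge1 : 1 <= q)
    (compact_X : compact X) (convex_X : convex_set X)
    (compact_Y : compact Y) (convex_Y : convex_set Y)
    (diam_Y_gt0 : 0 < diam Y)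
    (M_gt0 : 0 < M) (theta_gt0 : 0 < theta) (theta_le1 : theta <= 1)
    (rho0_X : rho0 X = 1%E)
    (rho0_ball : forall (x : 'rV[R]_d) (eta : R), 0 < eta ->
       (rho0 (eball x eta) <= (M * eta `^ (d%:R - 1 + theta))%:E)%E)
    (mu0_Y : mu0 Y = 1%E)
    (gamma0_opt : Gamma rho0 mu0 gamma0)
    (rho1 mu1 : probability (borel_rV R d) R)
    (gamma1 : probability (borel_rV R d * borel_rV R d)%type R)
    (rho1_X : rho1 X = 1%E) (mu1_Y : mu1 Y = 1%E)
    (gamma1_opt : Gamma rho1 mu1 gamma1) :
  (Wplan q gamma0 gamma1 <=
     (C_ d q M theta (diam X) (diam Y))%:E
     * (W1 rho0 rho1 + W1 mu0 mu1) `^ (theta / (q * (1 + theta))))%E.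
Proof.
case: d => [//|n] in X Y rho0 mu0 gamma0 d_ge2 compact_X convex_X compact_Y convex_Y
  diam_Y_gt0 rho0_X rho0_ball mu0_Y gamma0_opt rho1 mu1 gamma1 rho1_X mu1_Y gamma1_opt *.
have n_gt0 : (0 < n)%N by [].
have DX0 := diam_gt0 compact_X M_gt0 theta_gt0 rho0_X rho0_ball.
have k0 : 0 <= c_ R n.+1 * M * diam X `^ (n.+1%:R - 1 + theta).
  apply: le_trans (constant_ge108 compact_X n_gt0 M_gt0 theta_gt0 theta_le1
    rho0_X rho0_ball); lra.
set W := (W1 rho0 rho1 + W1 mu0 mu1)%E; set C := C_ _ _ _ _ _ _.
set r := theta / _.
have C0 : 0 < C by exact: C_gt0.
have r0 : 0 < r by rewrite divr_gt0// mulr_gt0//; lra.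
have W0 : (0 <= W)%E by rewrite adde_ge0// W1_ge0.
have qi0 : 0 <= q^-1 by rewrite invr_ge0; lra.
have above w : (W < w%:E)%E -> (Wplan q gamma0 gamma1 <= (C * w `^ r)%:E)%E.
  move=> Ww; have w0 : 0 <= w by rewrite -lee_fin; apply: le_trans W0 (ltW Ww).
  apply: (@le_trans _ _ ((2 * (Num.max (diam X) (diam Y) * w / (diam X * diam Y))
      `^ (theta / (1 + theta)) * (diam X `^ q + diam Y `^ q *
      (1 + c_ R n.+1 * M * diam X `^ (n.+1%:R - 1 + theta)))) `^ q^-1)%:E).
    rewrite -poweR_EFin /Wplan; apply: gt0_ler_poweR => //.
    - rewrite in_itv/= leey andbT; apply: le_ereal_inf_tmp => _ [pi _ <-].
      by apply: integral_ge0 => z _; rewrite lee_fin addr_ge0// powR_ge0.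
    - rewrite in_itv/= leey andbT lee_fin !mulr_ge0 ?powR_ge0//.
      by rewrite addr_ge0 ?powR_ge0// mulr_ge0 ?powR_ge0// addr_ge0.
    exact: (transport_cost_le n_gt0 q_ge1 compact_X compact_Y diam_Y_gt0 M_gt0
      theta_gt0 theta_le1 rho0_X rho0_ball mu0_Y rho1_X mu1_Y gamma0_opt gamma1_opt).
  by rewrite lee_fin; exact: root_cost_le.
have U0 : (0 <= Wplan q gamma0 gamma1)%E by exact: poweR_ge0.
case EW: W W0 => [v| |] //; last first.
  by move=> _; rewrite poweRyr ?gt_eqF// gt0_muley ?lte_fin// leey.
rewrite lee_fin => v0; rewrite poweR_EFin -EFinM.
have Ufin : Wplan q gamma0 gamma1 \is a fin_num.
  rewrite ge0_fin_numE//; apply: le_lt_trans (ltry (C * (v + 1) `^ r)).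
  by apply: above; rewrite EW lte_fin; lra.
move: above U0; rewrite -(fineK Ufin); set u := fine _ => above.
rewrite !lee_fin => u0; rewrite leNgt; apply/negP => lt.
(* [w0] is the value for which the bound equals [u]. It would exceed [v], and
   the midpoint of [v] and [w0] then contradicts the bound. *)
pose w0 := (u / C) `^ r^-1.
have uC : 0 <= u / C by rewrite divr_ge0// ltW.
have w0r : C * w0 `^ r = u.
  by rewrite /w0 -powRrM mulVf ?gt_eqF// powRr1// mulrC divfK// gt_eqF.
have vw0 : v < w0.
  rewrite -[v]powRr1// -(mulfV (lt0r_neq0 r0)) powRrM.
  apply: gt0_ltr_powR; rewrite ?invr_gt0 ?nnegrE ?powR_ge0//.
  by rewrite ltr_pdivlMr// mulrC.
have := above ((v + w0) / 2); rewrite EW lte_fin lee_fin => /(_ ltac:(lra)).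
apply/negP; rewrite -ltNge -[ltRHS]w0r ltr_pM2l//.
by apply: gt0_ltr_powR; rewrite ?nnegrE//; lra.
Qed.
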